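(* Fix an s-regular summation method $\{p_{\alpha,n}\}_{\alpha\in E,\, n\in\mathbb{Z}_+}$. Let $H_1,H_2$ be Hilbert spaces, let $U_1:H_1\to H_1$ and $U_2:H_2\to H_2$ be singular unitary operators, and let $A:H_1\to H_2$ be a bounded operator such that $\operatorname{rank}(AU_1-U_2A)\le 2$. Put $$W_+(\alpha)=\sum_{n=0}^{\infty}p_{\alpha,n}U_2^{-n}AU_1^{n},\qquad W_-(\alpha)=\sum_{n=0}^{\infty}p_{\alpha,n}U_2^{n}AU_1^{-n},\qquad \alpha\in E.$$ Then the limit $\lim_\alpha\,(W_+(\alpha)-W_-(\alpha))$ exists in the weak operator topology and equals zero. In particular, the weak averaged wave operators $W_+=\lim_\alpha W_+(\alpha)$ and $W_-=\lim_\alpha W_-(\alpha)$ (limits in the weak operator topology) do or do not exist simultaneously, and if they exist, they coincide.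
   Context: Hilbert spaces are complex. $\mathbb{Z}_+$ is the set of nonnegative integers. Let $(E,\prec)$ be a totally ordered set; $\lim_\alpha$ denotes the limit along $E$ in the increasing direction (limit of nets). A family of nonnegative numbers $\{p_{\alpha,n}\}_{\alpha\in E,\,n\in\mathbb{Z}_+}$ determines an s-regular summation method if: (i) $\sum_n p_{\alpha,n}=1$ for every $\alpha\in E$; (ii) $\lim_\alpha\sum_n|p_{\alpha,n}-p_{\alpha,n+1}|=0$; (iii) $\lim_\alpha p_{\alpha,n}=0$ for every $n\in\mathbb{Z}_+$. A unitary operator is called singular if its spectral measure is singular with respect to Lebesgue measure on the unit circle $\mathbb{T}$. *)

(* Defs.v *)
From HB Require Import structures.
From mathcomp Require Import all_boot all_order all_algebra.
From mathcomp Require Import sesquilinear complex.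
From mathcomp Require Import all_classical all_reals all_analysis.

Set Implicit Arguments.
Unset Strict Implicit.
Unset Printing Implicit Defensive.

Import Order.TTheory GRing.Theory Num.Theory.
Import numFieldNormedType.Exports.

Local Open Scope classical_set_scope.
Local Open Scope ring_scope.
Local Open Scope complex_scope.

(* [inner] is linear in its first and conjugate-linear in its second argument. *)
HB.mixin Record NormedModule_isHilbert (R : realType) (H : Type)
    of CompleteNormedModule R[i] H := {
  inner : {dot H for @Num.conj R[i]} ;
  inner_norm : forall x : H, `|x| ^+ 2 = inner x x
}.

#[short(type="hilbertType")]
HB.structure Definition Hilbert (R : realType) :=
  {H of CompleteNormedModule R[i] H & NormedModule_isHilbert R H}.

Notation "''[' x , y ]" := (inner x y) : ring_scope.

(* The filter of the net limit along a totally ordered set: the tails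
   {b | a <= b}. It is not a filter (nothing converges along it) when E is
   empty. *)
Definition tails (disp : Order.disp_t) (E : orderType disp) : set_system E :=
  filter_from setT (fun a : E => [set b | (a <= b)%O]).
Arguments tails {disp} E.

Definition s_regular (R : realType) (disp : Order.disp_t) (E : orderType disp)
    (p : E -> nat -> R) : Prop :=
  [/\ forall a n, 0 <= p a n,
      forall a, (\sum_(0 <= n <oo) (p a n)%:E = 1)%E,
      (fun a => \sum_(0 <= n <oo) `|p a n - p a n.+1|%:E)%E
        @ tails E --> 0%E
    & forall n, p a n @[a --> tails E] --> (0 : R)].

Section Operators.
Variable R : realType.

Definition bounded_op (H1 H2 : hilbertType R) (f : H1 -> H2) : Prop :=
  exists M : R[i], forall x, `|f x| <= M * `|x|.

Definition rank_le (H1 H2 : hilbertType R) (r : nat) (f : H1 -> H2) : Prop :=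
  exists b : 'I_r -> H2,
    range f = [set y | exists c : 'I_r -> R[i], y = \sum_i c i *: b i].

Record unitary (H : hilbertType R) := Unitary {
  uop :> {linear H -> H} ;
  uinv : H -> H ;
  uopK : cancel uop uinv ;
  uinvK : cancel uinv uop ;
  uop_inner : forall x y, '[uop x, uop y] = '[x, y]
}.

Definition borelC := g_sigma_algebraType (@open R[i]^o).

Definition circle : set borelC := [set z : R[i] | `|z| = 1].

Definition arc_length (N : set borelC) : \bar R :=
  lebesgue_measure
    ([set t : R | 0 <= t < 2 * pi] `&` [set t : R | N (cos t +i* sin t)]).

(* Projection-valued measures on the Borel sets of C that are concentrated on
   the unit circle; [scalar_measure x] is S |-> <P S x, x>. *)
Record spectral_measure (H : hilbertType R) := SpectralMeasure {
  sproj :> set borelC -> {linear H -> H} ;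
  scalar_measure : H -> {measure set borelC -> \bar R} ;
  sproj_selfadjoint : forall S, measurable S ->
    forall x y, '[sproj S x, y] = '[x, sproj S y] ;
  sprojI : forall S T, measurable S -> measurable T ->
    forall x, sproj (S `&` T) x = sproj S (sproj T x) ;
  sproj_circle : forall x, sproj circle x = x ;
  scalar_measureE : forall x S, measurable S ->
    scalar_measure x S = (complex.Re '[sproj S x, x])%:E
}.

(* U = \int z dP(z), as an identity of quadratic forms; these determine
   operators since the scalars are complex. *)
Definition is_spectral_measure (H : hilbertType R) (U : unitary H)
    (P : spectral_measure H) : Prop :=
  forall x, '[U x, x] =
    (\int[scalar_measure P x]_(z in circle) complex.Re z)
    +i* (\int[scalar_measure P x]_(z in circle) complex.Im z).

(* The null set may depend on x; on a separable space it can be chosen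
   independently of x. *)
Definition singular_measure (H : hilbertType R) (P : spectral_measure H) : Prop :=
  forall x, exists2 N : set borelC, measurable N &
    arc_length N = 0%E /\ scalar_measure P x (~` N) = 0%E.

Definition singular_unitary (H : hilbertType R) (U : unitary H) : Prop :=
  exists2 P : spectral_measure H, is_spectral_measure U P & singular_measure P.

Section WaveOperators.
Variables (disp : Order.disp_t) (E : orderType disp) (p : E -> nat -> R).
Variables (H1 H2 : hilbertType R).

(* The series converge absolutely in operator norm; here they are summed
   pointwise in the norm of H2. *)
Definition Wplus (U1 : unitary H1) (U2 : unitary H2) (A : H1 -> H2) (a : E) :
    H1 -> H2 :=
  fun x => limn (series (fun n =>
    (p a n)%:C *: iter n (uinv U2) (A (iter n U1 x)))).

Definition Wminus (U1 : unitary H1) (U2 : unitary H2) (A : H1 -> H2) (a : E) :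
    H1 -> H2 :=
  fun x => limn (series (fun n =>
    (p a n)%:C *: iter n U2 (A (iter n (uinv U1) x)))).

Definition wot_lim (W : E -> H1 -> H2) (L : H1 -> H2) : Prop :=
  forall (x : H1) (y : H2),
    (fun a => '[W a x, y] : R[i]^o) @ tails E --> ('[L x, y] : R[i]^o).

Definition wot_cvg (W : E -> H1 -> H2) : Prop :=
  exists2 L : {linear H1 -> H2}, bounded_op L & wot_lim W L.

End WaveOperators.
End Operators.

(* Main.v *)
Require Import Defs.
From mathcomp Require Import all_boot all_order all_algebra.
From mathcomp Require Import sesquilinear complex.
From mathcomp Require Import all_classical all_reals all_analysis.
From mathcomp Require Import measurable_realfun ring lra.

Set Implicit Arguments.
Unset Strict Implicit.
Unset Printing Implicit Defensive.

Import Order.TTheory GRing.Theory Num.Theory.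
Import numFieldNormedType.Exports.

Local Open Scope classical_set_scope.
Local Open Scope ring_scope.
Local Open Scope complex_scope.

Import Normc.

(** Write a_m = <A U1^m x, U2^m y> for an integer m.  Then
    <(W_+(alpha) - W_-(alpha)) x, y> is the p_alpha-mean of a_n - a_{-n}.  By
    s-regularity these means become shift invariant along the net, so every
    limit of them along an ultrafilter finer than the tails is a Banach limit,
    and it is enough to show that L(a_n - a_{-n}) = 0 for every Banach limit L
    ([mean_cvg0]).

    Fix L.  The form L(a_n - a_{-n}) is bounded, so it is <D x, y> for an
    operator D; shift invariance gives D U1 = U2 D ([wave_limit_op]).  Let
    K = A U1 - U2 A = sum_k <., u_k> v_k, where k takes two values.  Telescoping,
    a_n - a_{-n} = sum_{-n <= j < n} sum_k <U1^j x, u_k> <v_k, U2^(j+1) y>.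

    Singularity enters only through a trace formula: if U is a singular unitary
    operator, B is bounded and BU - UB has finite rank, then tr(BU - UB) = 0
    ([trace_commutator_eq0]).  Indeed the spectral measure lives on a null set,
    which is covered by discs of small total radius; on the spectral subspace of
    each disc U is almost scalar, so the commutator has a small trace there.
    For every bounded T with T U2 = U1 T the operator TA has the commutator TK
    with U1, hence sum_k <T v_k, u_k> = 0 ([trace_intertwiner]).

    Apply this with T = U1^j D*: the 2 x 2 matrices C_j = (<U1^j D* v_l, u_k>)
    have trace zero.  By the telescoping formula, <U1^s D*DD* v_l, u_k> is the
    Banach limit of the entries of sum_{-n <= j < n} C_{-1-j} C_{s+j}.  Since
    D*DD* can be moved past powers of the unitaries, the product in the
    opposite order has the same Banach limit, so twice this number is the limit
    of the entries of a sum of anticommutators.  The anticommutator of two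
    traceless 2 x 2 matrices is scalar: this is where rank 2 matters.  So the
    matrix (<U1^s D*DD* v_l, u_k>) is scalar; by the trace formula for
    T = U1^s D*DD* it is traceless, hence zero ([cubic_coef_eq0]).  It follows
    successively that DD*DD* v_l = 0, D* v_l = 0 and D = 0
    ([wave_limit_eq0]). *)

(** * Inner products, real-valued norms and the Cauchy-Schwarz inequality *)

Section ComplexModulus.
Variable R : realType.
Implicit Types (a b : R[i]) (t : R).

Lemma normcR t : normc t%:C = `|t|.
Proof. by rewrite /= expr0n addr0 sqrtr_sqr. Qed.

Lemma normc_ge0 a : 0 <= normc a.
Proof. by case: a => x y; apply: sqrtr_ge0. Qed.

Lemma normE_C a : `|a| = (normc a)%:C.
Proof. by []. Qed.

Lemma Re_le_normc a : `|complex.Re a| <= normc a.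
Proof. by case: a => x y /=; rewrite -sqrtr_sqr ler_wsqrtr // lerDl sqr_ge0. Qed.

Lemma Im_le_normc a : `|complex.Im a| <= normc a.
Proof. by case: a => x y /=; rewrite -sqrtr_sqr ler_wsqrtr // lerDr sqr_ge0. Qed.

Lemma normc_le_ReIm a : normc a <= `|complex.Re a| + `|complex.Im a|.
Proof.
case: a => x y /=.
rewrite -[leRHS]ger0_norm ?addr_ge0 // -sqrtr_sqr ler_wsqrtr // sqrrD.
by rewrite !real_normK ?num_real // lerD2r lerDl mulrn_wge0 // mulr_ge0.
Qed.

Lemma normcJ a : normc (conjc a) = normc a.
Proof. by case: a => x y /=; rewrite sqrrN. Qed.

Lemma mul_conjc a : a * conjc a = (normc a ^+ 2)%:C.
Proof.
case: a => x y /=; rewrite sqr_sqrtr ?addr_ge0 ?sqr_ge0 //.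
by apply/eqP; rewrite eq_complex /=; apply/andP; split; apply/eqP; ring.
Qed.

Lemma normc_unit a : exists2 c : R[i], normc c = 1 & c * a = (normc a)%:C.
Proof.
have [->|a0] := eqVneq a 0; first by exists 1; rewrite ?normc1 // mulr0 normc0.
have na : normc a != 0 by apply: contra_neq a0; apply: eq0_normc.
exists ((normc a)%:C / a); last by rewrite divfK.
by rewrite normcM normcV normcR ger0_norm ?normc_ge0 // divff.
Qed.

End ComplexModulus.

Section InnerProduct.
Variables (R : realType) (H : hilbertType R).
Implicit Types (x y z : H) (a : R[i]).

Lemma innerDl x y z : '[x + y, z] = '[x, z] + '[y, z].
Proof. by rewrite linearDl. Qed.

Lemma innerDr x y z : '[z, x + y] = '[z, x] + '[z, y].
Proof. by rewrite linearDr. Qed.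

Lemma innerZl a x z : '[a *: x, z] = a * '[x, z].
Proof. by rewrite linearZl_LR. Qed.

Lemma innerZr a x z : '[z, a *: x] = conjc a * '[z, x].
Proof. by rewrite linearZr_LR. Qed.

Lemma innerC x y : '[y, x] = conjc '[x, y].
Proof. by rewrite hermC expr0 mul1r. Qed.

Lemma inner0l x : '[0, x] = 0.
Proof. by rewrite -(scale0r 0) innerZl mul0r. Qed.

Lemma inner0r x : '[x, 0] = 0.
Proof. by rewrite innerC inner0l conjc0. Qed.

Lemma innerNl x y : '[- x, y] = - '[x, y].
Proof. by rewrite -scaleN1r innerZl mulN1r. Qed.

Lemma innerNr x y : '[x, - y] = - '[x, y].
Proof. by rewrite innerC innerNl rmorphN /= -innerC. Qed.

Lemma innerBl x y z : '[x - y, z] = '[x, z] - '[y, z].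
Proof. by rewrite innerDl innerNl. Qed.

Lemma innerBr x y z : '[z, x - y] = '[z, x] - '[z, y].
Proof. by rewrite innerDr innerNr. Qed.

Lemma inner_suml (I : Type) (r : seq I) (Q : pred I) (F : I -> H) z :
  '[\sum_(i <- r | Q i) F i, z] = \sum_(i <- r | Q i) '[F i, z].
Proof.
by apply: (big_morph (inner^~ z)) => [x y|]; rewrite ?innerDl ?inner0l.
Qed.

Lemma inner_sumr (I : Type) (r : seq I) (Q : pred I) (F : I -> H) z :
  '[z, \sum_(i <- r | Q i) F i] = \sum_(i <- r | Q i) '[z, F i].
Proof.
by apply: (big_morph (inner z)) => [x y|]; rewrite ?innerDr ?inner0r.
Qed.

(** The norm of a Hilbert space has values in [R[i]]; its real part is the norm
    as a real number, so that inequalities can be compared in [R]. *)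
Definition nrm x : R := complex.Re `|x|.

Lemma normE x : `|x| = (nrm x)%:C.
Proof. by rewrite /nrm RRe_real // ger0_real. Qed.

Lemma nrm_ge0 x : 0 <= nrm x.
Proof. by rewrite -ler0c -normE. Qed.

Lemma inner_nrm x : '[x, x] = (nrm x ^+ 2)%:C.
Proof. by rewrite -inner_norm normE rmorphXn. Qed.

Lemma inner_eq0 x : '[x, x] = 0 -> x = 0.
Proof. by rewrite -inner_norm => /eqP; rewrite sqrf_eq0 normr_eq0 => /eqP. Qed.

Lemma nrm_eq0 x : nrm x = 0 -> x = 0.
Proof. by move=> x0; apply: inner_eq0; rewrite inner_nrm x0 expr0n. Qed.

Lemma nrmZ a x : nrm (a *: x) = normc a * nrm x.
Proof. by apply: complexI; rewrite -normE normrZ normE rmorphM. Qed.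

Lemma nrmD x y : nrm (x + y) <= nrm x + nrm y.
Proof. by rewrite -lecR rmorphD /= -!normE ler_normD. Qed.

Lemma nrmN x : nrm (- x) = nrm x.
Proof. by rewrite /nrm normrN. Qed.

Lemma nrm0 : nrm 0 = 0.
Proof. by rewrite /nrm normr0. Qed.

Lemma inner_ext x y : (forall z, '[x, z] = '[y, z]) -> x = y.
Proof.
by move=> e; apply/eqP; rewrite -subr_eq0; apply/eqP/inner_eq0;
  rewrite innerBl e subrr.
Qed.

Lemma inner_extr x y : (forall z, '[z, x] = '[z, y]) -> x = y.
Proof. by move=> e; apply: inner_ext => z; rewrite innerC e -innerC. Qed.

Lemma nrmD2 x y : nrm (x + y) ^+ 2 =
  nrm x ^+ 2 + nrm y ^+ 2 + 2 * complex.Re '[x, y].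
Proof.
have: '[x + y, x + y] = '[x, x] + '[y, y] + ('[x, y] + conjc '[x, y]).
  by rewrite !(innerDl, innerDr) (innerC x y); ring.
rewrite addcJ !inner_nrm => /(congr1 (@complex.Re R)).
by case: ('[x, y]) => a b /=; rewrite !addr0 => ->; ring.
Qed.

Lemma nrmB2 x y : nrm (x - y) ^+ 2 =
  nrm x ^+ 2 + nrm y ^+ 2 - 2 * complex.Re '[x, y].
Proof. by rewrite nrmD2 nrmN innerNr; case: ('[x, y]) => a b /=; ring. Qed.

(** Expand the norm of [nrm y *: x - nrm x *: y]. *)
Lemma Re_inner_le x y : complex.Re '[x, y] <= nrm x * nrm y.
Proof.
have [->|x0] := eqVneq x 0; first by rewrite inner0l nrm0 mul0r.
have [->|y0] := eqVneq y 0; first by rewrite inner0r nrm0 mulr0.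
have nx : 0 < nrm x.
  by rewrite lt_def nrm_ge0 andbT; apply: contra_neq x0 => /nrm_eq0.
have ny : 0 < nrm y.
  by rewrite lt_def nrm_ge0 andbT; apply: contra_neq y0 => /nrm_eq0.
have := sqr_ge0 (nrm ((nrm y)%:C *: x - (nrm x)%:C *: y)).
rewrite nrmB2 !nrmZ innerZl innerZr conjc_real.
rewrite !normcR !ger0_norm ?nrm_ge0 //.
case: ('[x, y]) => a b /=; rewrite !(mul0r, mulr0, subr0, addr0).
move=> h; have hxy : 0 < nrm x * nrm y by rewrite mulr_gt0.
rewrite -(ler_pM2l hxy); nra.
Qed.

(** Multiplying [x] by a suitable unimodular scalar makes the inner product real
    and nonnegative. *)
Lemma cauchy_schwarz x y : normc '[x, y] <= nrm x * nrm y.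
Proof.
have [c c1 ca] := normc_unit '[x, y].
have := Re_inner_le (c *: x) y.
by rewrite innerZl ca nrmZ c1 mul1r.
Qed.

End InnerProduct.

(** * The Riesz representation theorem *)

Section Completeness.
Variables (R : realType) (H : hilbertType R).

Lemma nrm_cvgP (x : nat -> H) l : x @ \oo --> l <->
  forall e : R, 0 < e -> exists N, forall n, (N <= n)%N -> nrm (x n - l) < e.
Proof.
split=> [/cvgrPdist_lt xl e e0|xl].
  have [|N _ hN] := xl e%:C; first by rewrite ltcR.
  by exists N => n Nn; rewrite -ltcR -normE distrC; apply: hN.
apply/cvgrPdist_lt => -[e e']; rewrite ltcE /= => /andP[/eqP -> e0].
have [N hN] := xl _ e0; exists N => // n /= Nn.
by rewrite distrC normE ltcR; apply: hN.
Qed.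

Lemma nrm_complete (x : nat -> H) :
  (forall e : R, 0 < e -> exists N, forall m n, (N <= m)%N -> (N <= n)%N ->
     nrm (x m - x n) < e) ->
  exists l, forall e : R, 0 < e ->
    exists N, forall n, (N <= n)%N -> nrm (x n - l) < e.
Proof.
move=> cx; suff /cauchy_cvgP cvx : cauchy (x @ \oo).
  by exists (limn x); apply/nrm_cvgP.
apply/cauchy_exP => -[e e']; rewrite ltcE /= => /andP[/eqP -> e0].
have [N hN] := cx _ e0; exists (x N).
exists N => // n /= Nn; rewrite -ball_normE /= normE ltcR.
exact: hN.
Qed.

End Completeness.

Section Riesz.
Variables (R : realType) (H : hilbertType R).

Lemma quadratic_ge0 (b c : R) :
  0 <= b -> (forall t, 0 <= t ^+ 2 * b + 2 * t * c) -> c = 0.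
Proof.
move=> b0 h; have b1 : 0 < b + 1 by lra.
have := h (- c / (b + 1)).
have -> : (- c / (b + 1)) ^+ 2 * b + 2 * (- c / (b + 1)) * c =
   - (c ^+ 2 * (b + 2)) / (b + 1) ^+ 2 by field; lra.
rewrite pmulr_lge0 ?invr_gt0 ?exprn_gt0 // oppr_ge0 => h'.
apply/eqP; rewrite -sqrf_eq0 eq_le sqr_ge0 andbT.
by rewrite pmulr_lle0 // in h'; lra.
Qed.

Variables (phi : H -> R[i]) (M : R).
Hypothesis phi_lin : forall a x y, phi (a *: x + y) = a * phi x + phi y.
Hypothesis phi_bound : forall x, normc (phi x) <= M * nrm x.

(** The Riesz functional: it is minimal exactly at the representing vector. *)
Let J x := nrm x ^+ 2 - 2 * complex.Re (phi x).

Let phiD x y : phi (x + y) = phi x + phi y.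
Proof. by rewrite -{1}[x]scale1r phi_lin mul1r. Qed.

Let phi0 : phi 0 = 0.
Proof. by apply: (addIr (phi 0)); rewrite -phiD !add0r. Qed.

Let phiZ a x : phi (a *: x) = a * phi x.
Proof. by rewrite -[_ *: _]addr0 phi_lin phi0 addr0. Qed.

Let Rephi x : `|complex.Re (phi x)| <= M * nrm x.
Proof. exact: le_trans (Re_le_normc _) (phi_bound _). Qed.

Let J_add x d :
  J (x + d) = J x + nrm d ^+ 2 + 2 * (complex.Re '[x, d] - complex.Re (phi d)).
Proof. by rewrite /J nrmD2 phiD; case: (phi x) (phi d) => [a b] [a' b'] /=; ring. Qed.

(** The parallelogram law: approximate minimizers of [J] are close to each
    other. *)
Let J_par x y :
  nrm (x - y) ^+ 2 = 2 * (J x + J y - 2 * J ((1 / 2)%:C *: (x + y))).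
Proof.
rewrite /J nrmZ phiZ normcR exprMn nrmB2 nrmD2 phiD ger0_norm //.
by case: (phi x) (phi y) => [a b] [a' b'] /=; field.
Qed.

(** A minimizing sequence of [J] is Cauchy by [J_par]; at its limit the first
    variation of [J] vanishes in every direction, which gives the real part of
    the identity, and the directions [x] and ['i *: x] together give all of it. *)
Theorem riesz : exists u, forall x, phi x = '[x, u].
Proof.
have lbJ : lbound (range J) (- M ^+ 2).
  move=> _ [x _ <-]; rewrite /J.
  have := le_trans (ler_norm _) (Rephi x); have := sqr_ge0 (nrm x - M); nra.
have infJ : has_inf (range J) by split; [exists (J 0), 0|exists (- M ^+ 2)].
pose i := inf (range J).
have iJ x : i <= J x by apply: ge_inf; [exists (- M ^+ 2)|exists x].
have exx n : exists x, J x < i + n.+1%:R^-1.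
  have n0 : 0 < n.+1%:R^-1 :> R by rewrite invr_gt0.
  by have [_ [x _ <-] hx] := inf_adherent n0 infJ; exists x.
have [x hx] := choice exx.
have [|u hu] := @nrm_complete _ _ x.
  move=> e e0.
  have e4 : 0 < e ^+ 2 / 4 by rewrite divr_gt0 ?exprn_gt0.
  have [N _ hN] := near_infty_natSinv_lt (PosNum e4).
  exists N => m n Nm Nn; rewrite -(@ltr_pXn2r _ 2) ?nnegrE ?nrm_ge0 ?ltW //.
  rewrite J_par.
  have := hx m; have := hx n; have := iJ ((1 / 2)%:C *: (x m + x n)).
  have /= := hN _ Nm; have /= := hN _ Nn.
  move: (n.+1%:R^-1) (m.+1%:R^-1) (J (x m)) (J (x n)) (J _) => *; lra.
(* The limit is a minimizer, because [J] is continuous at [u]. *)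
have Ju : J u <= i.
  apply/ler_addgt0Pr => e e0.
  pose k := 2 * (nrm u + `|M|) + 1.
  have k0 : 0 < k by rewrite /k; have := nrm_ge0 u; have := normr_ge0 M; lra.
  have e2 : 0 < e / 2 by lra.
  have [N _ hN] := near_infty_natSinv_lt (PosNum e2).
  have [N' hN'] := hu _ (divr_gt0 e2 k0).
  pose n := maxn N N'; pose d := x n - u.
  have /= h1 := hN n (leq_maxl _ _); have h2 := hN' n (leq_maxr _ _).
  have := hx n; have -> : x n = u + d by rewrite /d addrC subrK.
  rewrite J_add.
  have hd : nrm d * k < e / 2 by rewrite -ltr_pdivlMr.
  have d0 := nrm_ge0 d.
  have := Re_inner_le (- u) d; rewrite innerNl nrmN.
  have := le_trans (ler_norm _) (Rephi d).
  have hM : M * nrm d <= `|M| * nrm d by rewrite ler_wpM2r // ler_norm.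
  rewrite raddfN /=; move: (complex.Re _) (complex.Re _) => a b.
  move: (n.+1%:R^-1) h1 (J u) => q h1 j h3 h4 h5.
  rewrite /k in hd; have := sqr_ge0 (nrm d); lra.
have Re_eq z : complex.Re '[u, z] = complex.Re (phi z).
  apply/eqP; rewrite -subr_eq0; apply/eqP.
  apply: (@quadratic_ge0 (nrm z ^+ 2)); first exact: sqr_ge0.
  move=> t; have := le_trans Ju (iJ (u + t%:C *: z)).
  rewrite J_add innerZr phiZ nrmZ normcR conjc_real exprMn real_normK ?num_real //.
  by case: ('[u, z]) (phi z) => [a b] [a' b'] /=; lra.
exists u => z; rewrite innerC.
have := Re_eq z; have := Re_eq ('i *: z); rewrite innerZr phiZ.
by case: ('[u, z]) (phi z) => [a b] [a' b'] /= h1 h2; apply/eqP;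
  rewrite eq_complex /=; apply/andP; split; apply/eqP; lra.
Qed.

End Riesz.

(** * Adjoints, integer powers of unitary operators and Parseval frames *)

Section Adjoints.
Variables (R : realType) (H1 H2 H3 : hilbertType R).

(** A map that has an adjoint is automatically linear, so that compositions of
    operators need no bundled structure. *)
Definition adjoint_pair (H H' : hilbertType R) (f : H -> H') (g : H' -> H) :=
  forall x y, '[f x, y] = '[x, g y].

Definition opbound (H H' : hilbertType R) (M : R) (f : H -> H') :=
  forall x, nrm (f x) <= M * nrm x.

Lemma adjointC (f : H1 -> H2) g : adjoint_pair f g -> adjoint_pair g f.
Proof. by move=> fg x y; rewrite innerC -fg -innerC. Qed.

Lemma adjoint_comp (f : H1 -> H2) g (f' : H2 -> H3) g' :
  adjoint_pair f g -> adjoint_pair f' g' ->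
  adjoint_pair (f' \o f) (g \o g').
Proof. by move=> fg fg' x y /=; rewrite fg' fg. Qed.

Lemma adjoint_linear (f : H1 -> H2) g : adjoint_pair f g -> linear f.
Proof.
by move=> fg a x y; apply: inner_ext => z; rewrite fg !(innerDl, innerZl) !fg.
Qed.

Lemma opbound_comp M M' (f : H1 -> H2) (f' : H2 -> H3) :
  0 <= M' -> opbound M f -> opbound M' f' -> opbound (M' * M) (f' \o f).
Proof.
move=> M0 bf bf' x /=; apply: le_trans (bf' _) _.
by rewrite -mulrA ler_wpM2l.
Qed.

Lemma bounded_opE (f : H1 -> H2) : bounded_op f ->
  exists2 M : R, 0 <= M & opbound M f.
Proof.
move=> [[a b] hM]; exists `|a| => // x.
have := hM x; rewrite !normE lecE /= => /andP[_].
rewrite mulr0 subr0 => /le_trans; apply.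
by rewrite ler_wpM2r ?nrm_ge0 // ler_norm.
Qed.

(** Riesz in each variable separately. *)
Lemma sesquilinear_riesz (d : H1 -> H2 -> R[i]) (M : R) :
  (forall a x y z, d (a *: x + y) z = a * d x z + d y z) ->
  (forall a x y z, d z (a *: x + y) = conjc a * d z x + d z y) ->
  0 <= M -> (forall x y, normc (d x y) <= M * nrm x * nrm y) ->
  exists D D', [/\ forall x y, d x y = '[D x, y], adjoint_pair D D',
    opbound M D & opbound M D'].
Proof.
move=> dl dr M0 db.
have exD x : exists u, forall y, conjc (d x y) = '[y, u].
  apply: (@riesz _ _ _ (M * nrm x)) => [a y z|y]; last by rewrite normcJ.
  by rewrite dr rmorphD rmorphM /= conjcK.
have exD' y : exists u, forall x, d x y = '[x, u].
  apply: (@riesz _ _ _ (M * nrm y)) => [a x z|x]; first exact: dl.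
  by rewrite mulrAC.
have [D hD] := choice exD; have [D' hD'] := choice exD'.
have dD x y : d x y = '[D x, y] by rewrite innerC -hD conjcK.
have bound (H : hilbertType R) (z : H) k : 0 <= k ->
    normc '[z, z] <= k * nrm z -> nrm z <= k.
  move=> k0; rewrite inner_nrm normcR ger0_norm ?sqr_ge0 // expr2.
  have [->|z0] := eqVneq (nrm z) 0; first by [].
  by rewrite ler_pM2r // lt_def z0 nrm_ge0.
exists D, D'; split=> // [x y|x|y]; first by rewrite -dD hD'.
  by apply: bound; rewrite ?mulr_ge0 ?nrm_ge0 // -dD.
by apply: bound; rewrite ?mulr_ge0 ?nrm_ge0 // -hD' mulrAC.
Qed.

Lemma bounded_adjoint (A : {linear H1 -> H2}) : bounded_op A ->
  exists A', adjoint_pair A A'.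
Proof.
move=> /bounded_opE[M M0 bA].
have [|||D [D' [DA DD' _ _]]] :=
    @sesquilinear_riesz (fun x y => '[A x, y]) M _ _ M0.
- by move=> a x y z; rewrite linearP innerDl innerZl.
- by move=> a x y z; rewrite innerDr innerZr.
- move=> x y; apply: le_trans (cauchy_schwarz _ _) _.
  by rewrite ler_wpM2r ?nrm_ge0.
by exists D' => x y; rewrite DA.
Qed.

End Adjoints.

Section UnitaryPowers.
Variables (R : realType) (H : hilbertType R) (U : unitary H).

Lemma unitary_adjoint : adjoint_pair U (uinv U).
Proof. by move=> x y; rewrite -{1}[y](uinvK U) uop_inner. Qed.

Lemma nrm_unitary x : nrm (U x) = nrm x.
Proof. by rewrite /nrm; congr (complex.Re _); apply/eqP;
  rewrite -(@eqrXn2 _ 2) // !inner_norm uop_inner. Qed.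

Definition upow (m : int) : H -> H :=
  match m with Posz n => iter n U | Negz n => iter n.+1 (uinv U) end.

Lemma upow0 x : upow 0 x = x. Proof. by []. Qed.

Lemma upowS m x : upow (m + 1) x = U (upow m x).
Proof.
case: m => n; first by rewrite -PoszD addn1.
case: n => [|n]; last first.
  have -> : Negz n.+1 + 1 = Negz n.
    by rewrite !NegzE (intS n.+1) opprD addrAC addNr add0r.
  by rewrite /= uinvK.
by rewrite -[Negz 0 + 1]/(0 : int) /= uinvK.
Qed.

Lemma upowB m x : upow (m - 1) x = uinv U (upow m x).
Proof. by rewrite -{2}[m](subrK 1) upowS uopK. Qed.

Lemma upowD m n x : upow (m + n) x = upow m (upow n x).
Proof.
elim/int_rec: m => [|m IH|m IH]; first by rewrite add0r.
  by rewrite intS (addrC 1) addrAC !upowS IH.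
by rewrite intS opprD (addrC (- 1)) addrAC !upowB IH.
Qed.

Lemma upow_adjoint m : adjoint_pair (upow m) (upow (- m)).
Proof.
elim/int_rec: m => [x y|m IH x y|m IH x y]; first by rewrite oppr0.
  rewrite intS addrC upowS unitary_adjoint IH opprD upowD.
  by rewrite -[-1]add0r upowB upow0.
have upow1 z : upow 1 z = U z by [].
rewrite opprK in IH *; rewrite intS opprD (addrC (- 1)) upowB.
by rewrite (adjointC unitary_adjoint) IH opprD !opprK upowD upow1.
Qed.

Lemma nrm_upow m x : nrm (upow m x) = nrm x.
Proof.
have e : '[upow m x, upow m x] = '[x, x].
  by rewrite upow_adjoint -upowD addNr upow0.
apply/eqP; rewrite -(@eqrXn2 _ 2) ?nrm_ge0 //; apply/eqP.
by apply: complexI; rewrite -!inner_nrm.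
Qed.

End UnitaryPowers.

Section ParsevalFrame.
Variables (R : realType) (H : hilbertType R).

(** Gram-Schmidt in which normalizing the zero vector yields the zero vector:
    the vectors [es] are then a Parseval frame of the span of [ws].  In the
    induction, the orthogonality relations are used in the form that the frame
    also represents its own vectors.  The last clause will be applied to the
    range of a projection. *)
Lemma parseval_frame (ws : seq H) : exists es : seq H,
  [/\ size es = size ws, forall e, e \in es -> nrm e <= 1,
      forall w, w \in ws ++ es -> w = \sum_(e <- es) '[w, e] *: e &
      forall Q : H -> Prop, (forall a x y, Q x -> Q y -> Q (a *: x + y)) ->
        Q 0 -> (forall w, w \in ws -> Q w) -> forall e, e \in es -> Q e].
Proof.
elim: ws => [|w ws [es [Es es1 repr clos]]].
  by exists [::]; split=> // w; rewrite in_nil.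
pose p x := \sum_(e <- es) '[x, e] *: e.
pose w' := w - p w; pose e' := ((nrm w')^-1)%:C *: w'.
have inner_p x y : '[p x, y] = '[x, p y].
  rewrite inner_suml inner_sumr; apply: eq_bigr => e _.
  by rewrite innerZl innerZr -innerC mulrC.
have pe e : e \in es -> p e = e.
  by move=> ees; rewrite /p -repr // mem_cat ees orbT.
have ort e : e \in es -> '[e, e'] = 0.
  by move=> ees; rewrite innerZr innerBr -inner_p pe // subrr mulr0.
have ortp x : '[p x, e'] = 0.
  rewrite inner_suml big_seq big1 // => e ees.
  by rewrite innerZl ort // mulr0.
have w'E : w' = (nrm w')%:C *: e'.
  rewrite scalerA -rmorphM /=.
  have [/nrm_eq0 ->|/divff ->] := eqVneq (nrm w') 0; first by rewrite scaler0.
  by rewrite scale1r.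
have nrm_e' : e' = 0 \/ nrm e' = 1.
  rewrite nrmZ normcR ger0_norm ?invr_ge0 ?nrm_ge0 //.
  have [/nrm_eq0 w0|/mulVf ->] := eqVneq (nrm w') 0; last by right.
  by left; rewrite /e' w0 scaler0.
have e'e' : '[e', e'] *: e' = e'.
  case: nrm_e' => [->|e1]; first by rewrite scaler0.
  by rewrite inner_nrm e1 expr1n scale1r.
exists (e' :: es); split.
- by rewrite /= Es.
- move=> e; rewrite inE => /orP[/eqP->|/es1 //].
  by case: nrm_e' => ->; rewrite ?nrm0.
- move=> x; rewrite cat_cons inE mem_cat inE big_cons -/(p x).
  case/or4P => [/eqP->|xws|/eqP->|xes].
  + rewrite -{1}(subrK (p w) w) -/w'; congr (_ + _).
    rewrite -[X in '[X, _]](subrK (p w) w) -/w' innerDl ortp addr0.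
    by rewrite [X in '[X, _]]w'E innerZl -scalerA e'e' -w'E.
  + have px : x = p x by rewrite {1}[x]repr // mem_cat xws.
    by rewrite {2}px ortp scale0r add0r.
  + rewrite e'e' /p big_seq big1 ?addr0 // => e ees.
    by rewrite innerC ort // conjc0 scale0r.
  + by rewrite ort // scale0r add0r pe.
- move=> Q QD Q0 Qw e.
  have Qes f : f \in es -> Q f.
    by apply: clos => // x xws; apply: Qw; rewrite inE xws orbT.
  rewrite inE => /orP[/eqP->|/Qes //].
  have Qp : Q (p w).
    rewrite /p big_seq; apply: (big_ind Q) => // [x y Qx Qy|f fes].
      by rewrite -[x]scale1r; apply: QD.
    by rewrite -[_ *: f]addr0; apply: QD => //; apply: Qes.
  rewrite -[e']addr0; apply: (QD) => //; rewrite /w' addrC -scaleN1r.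
  by apply: QD => //; apply: Qw; rewrite mem_head.
Qed.

End ParsevalFrame.

(** * The trace of a finite rank commutator *)

Section TraceLemma.
Variables (R : realType) (H : hilbertType R) (U : unitary H).

Lemma normc_sum (I : Type) (s : seq I) (F : I -> R[i]) (G : I -> R) :
  (forall i, normc (F i) <= G i) -> normc (\sum_(i <- s) F i) <= \sum_(i <- s) G i.
Proof.
move=> FG; elim/big_rec2: _ => [|i a b _ h]; first by rewrite normc0.
by apply: le_trans (le_normcD _ _) _; rewrite lerD.
Qed.

Definition orth_proj (P : H -> H) :=
  adjoint_pair P P /\ forall x, P (P x) = P x.

Definition almost_scalar (P : H -> H) (z : R[i]) (d : R) :=
  normc z = 1 /\ forall x, P x = x -> nrm (U x - z *: x) <= d * nrm x.

(** The sum of the tolerances [d i], not only each of them, has to be small: each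
    one will bound a trace over a space of dimension at most [r], and these
    traces are added. *)
Definition nearly_diagonal := forall (r : nat) (v : 'I_r -> H) (e : R), 0 < e ->
  exists (n : nat) (P : 'I_n -> H -> H) (z : 'I_n -> R[i]) (d : 'I_n -> R),
    [/\ forall i, orth_proj (P i), forall i, almost_scalar (P i) (z i) (d i),
        (forall i, 0 <= d i), \sum_i d i <= e &
        forall k, nrm (v k - \sum_i P i (v k)) <= e].

Variables (r : nat) (u v : 'I_r -> H) (B B' : H -> H) (M : R).
Hypotheses (M0 : 0 <= M) (BB' : adjoint_pair B B') (bB : opbound M B).
Hypothesis commE : forall x, B (U x) - U (B x) = \sum_k '[x, u k] *: v k.

(** Replacing [U] by [U - z] does not change the commutator, and [U - z] and its
    adjoint are small at [e]. *)
Lemma commutator_almost_scalar (P : H -> H) z d e : 0 <= d ->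
  almost_scalar P z d -> P e = e -> nrm e <= 1 ->
  normc '[B (U e) - U (B e), e] <= 2 * M * d.
Proof.
move=> d0 [z1 aP] Pe e1.
have lB := adjoint_linear BB'.
have Ue : nrm (U e - z *: e) <= d.
  by apply: le_trans (aP _ Pe) _; rewrite ler_piMr.
have zz : z * conjc z = 1 by rewrite mul_conjc z1 expr1n.
pose f := uinv U e - conjc z *: e.
have nf : nrm f <= d.
  rewrite -(nrm_unitary U) linearB linearZ /= uinvK -nrmN opprB.
  have -> : conjc z *: U e - e = conjc z *: (U e - z *: e).
    by rewrite scalerBr scalerA mulrC zz scale1r.
  by rewrite nrmZ normcJ z1 mul1r.
have -> : '[B (U e) - U (B e), e] = '[B (U e - z *: e), e] - '[B e, f].
  have -> : U e - z *: e = (- z) *: e + U e by rewrite scaleNr addrC.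
  rewrite lB /f !(innerBl, innerBr, innerDl, innerZl, innerZr).
  by rewrite conjcK unitary_adjoint; ring.
apply: le_trans (le_normcD _ _) _; rewrite normcN.
have h1 := cauchy_schwarz (B (U e - z *: e)) e.
have h2 := cauchy_schwarz (B e) f.
have h3 := bB (U e - z *: e); have h4 := bB e.
have := nrm_ge0 e; have := nrm_ge0 f.
have : M * nrm (U e - z *: e) <= M * d by rewrite ler_wpM2l.
have : nrm (B (U e - z *: e)) * nrm e <= M * d.
  rewrite -[leRHS]mulr1; apply: ler_pM; rewrite ?nrm_ge0 //.
  by apply: le_trans h3 _; rewrite ler_wpM2l.
have : nrm (B e) * nrm f <= M * d.
  apply: ler_pM; rewrite ?nrm_ge0 //.
  by apply: le_trans h4 _; rewrite ler_piMr.
lra.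
Qed.

(** The left side is the trace of the commutator compressed to the span of the
    [P (v k)], a subspace of dimension at most [r] of the range of [P]; the
    trace is computed in a Parseval frame. *)
Lemma local_trace (P : H -> H) z d : 0 <= d -> orth_proj P ->
  almost_scalar P z d ->
  normc (\sum_k '[P (v k), u k]) <= 2 * M * d *+ r.
Proof.
move=> d0 [PP Pid] aP.
pose ws := [seq P (v k) | k <- enum 'I_r].
have [es [Es es1 repr clos]] := parseval_frame ws.
have Pes e : e \in es -> P e = e.
  apply: (clos (fun x => P x = x)).
  - by move=> a x y Px Py; rewrite (adjoint_linear PP) Px Py.
  - by apply: inner_ext => y; rewrite PP !inner0l.
  - by move=> _ /mapP[k _ ->].
have PvE k : P (v k) = \sum_(e <- es) '[v k, e] *: e.
  rewrite [LHS]repr; last by rewrite mem_cat map_f ?mem_enum.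
  by apply: eq_big_seq => e ees; rewrite PP Pes.
have -> : \sum_k '[P (v k), u k] = \sum_(e <- es) '[B (U e) - U (B e), e].
  under eq_bigr do rewrite PvE inner_suml.
  rewrite exchange_big; apply: eq_bigr => e _ /=.
  rewrite commE inner_suml; apply: eq_bigr => k _.
  by rewrite !innerZl mulrC.
rewrite big_seq_cond; under eq_bigl do rewrite andbT.
rewrite big_mkcond /=.
apply: le_trans (normc_sum _ (G := fun=> 2 * M * d) _) _.
  move=> e; case: ifP => ees; last by rewrite normc0 !mulr_ge0.
  by apply: commutator_almost_scalar aP _ _ => //; [exact: Pes|exact: es1].
by rewrite big_const_seq count_predT Es size_map size_enum_ord iter_addr addr0.
Qed.

(** Up to a small error, [v k] is the sum of its components [P i (v k)], and
    [local_trace] bounds the contribution of each [P i]. *)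
Lemma trace_commutator_eq0 : nearly_diagonal -> \sum_k '[v k, u k] = 0.
Proof.
move=> tU; apply: eq0_normc; apply/eqP; rewrite eq_le normc_ge0 andbT.
apply/ler_addgt0Pl => e e0; rewrite addr0.
pose c := 2 * M *+ r + \sum_k nrm (u k) + 1.
have c0 : 0 < c.
  by rewrite ltr_wpDl // addr_ge0 ?mulrn_wge0 ?mulr_ge0 // sumr_ge0 // => k _;
    exact: nrm_ge0.
have [n [P [z [d [hP aP d0 sd hv]]]]] := tU r v _ (divr_gt0 e0 c0).
have -> : \sum_k '[v k, u k] =
    \sum_k '[v k - \sum_i P i (v k), u k] + \sum_i \sum_k '[P i (v k), u k].
  rewrite exchange_big -big_split /=; apply: eq_bigr => k _.
  by rewrite innerBl -inner_suml subrK.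
apply: le_trans (le_normcD _ _) _.
have h1 : normc (\sum_k '[v k - \sum_i P i (v k), u k]) <=
    \sum_k (e / c * nrm (u k)).
  apply: normc_sum => k; apply: le_trans (cauchy_schwarz _ _) _.
  by rewrite ler_wpM2r ?nrm_ge0.
have h2 : normc (\sum_i \sum_k '[P i (v k), u k]) <= \sum_i (2 * M *+ r * d i).
  apply: normc_sum => i; rewrite mulrnAl; exact: local_trace (aP i).
rewrite -mulr_sumr in h1; rewrite -mulr_sumr in h2.
apply: le_trans (lerD h1 h2) _.
apply: le_trans (_ : e / c * (c - 1) <= _); last first.
  rewrite mulrBr mulr1 divfK ?gt_eqF // gerBl ltW // divr_gt0 //.
rewrite /c addrK mulrDr [leRHS]addrC lerD2l [leRHS]mulrC ler_wpM2l //.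
by rewrite mulrn_wge0 ?mulr_ge0.
Qed.
End TraceLemma.

(** * Covering a null subset of the circle *)

Section CircleCover.
Variable R : realType.

Lemma lipschitz_sin_cos (a t : R) :
  `|cos t - cos a| <= `|t - a| /\ `|sin t - sin a| <= `|t - a|.
Proof.
wlog le_at : a t / a <= t => [h|].
  have [/h //|/ltW /h] := leP a t.
  by rewrite (distrC t) (distrC (cos t)) (distrC (sin t)).
split.
  have [c _ ->] := MVT_segment le_at (fun x _ => is_derive_cos x)
    (continuous_subspaceT (@continuous_cos R)).
  by rewrite normrM normrN ler_piMl // sin_max.
have [c _ ->] := MVT_segment le_at (fun x _ => is_derive_sin x)
    (continuous_subspaceT (@continuous_sin R)).
by rewrite normrM ler_piMl // cos_max.
Qed.

Definition expi (t : R) : R[i] := cos t +i* sin t.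

Lemma normc_expi t : normc (expi t) = 1.
Proof. by rewrite /= cos2Dsin2 sqrtr1. Qed.

Lemma lipschitz_expi (a t : R) : normc (expi t - expi a) <= 2 * `|t - a|.
Proof.
apply: le_trans (normc_le_ReIm _) _ => /=.
by have [h1 h2] := lipschitz_sin_cos a t; rewrite mulrDl mul1r lerD.
Qed.

Lemma expi_surj (z : R[i]) : normc z = 1 ->
  exists2 t, 0 <= t < 2 * pi & z = expi t.
Proof.
case: z => x y /= /(congr1 (fun t => t ^+ 2)).
rewrite sqr_sqrtr ?addr_ge0 ?sqr_ge0 // expr1n => xy1.
have x1 : -1 <= x <= 1 by have := sqr_ge0 y; nra.
have h0 := acos_ge0 x1; have hpi := acos_lepi x1; have pi0 := pi_gt0 R.
have cx : cos (acos x) = x by rewrite acosK // in_itv.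
have sx : sin (acos x) = `|y|.
  by rewrite sin_acos // -sqrtr_sqr; congr Num.sqrt; lra.
have [y0|y0] := leP 0 y.
  exists (acos x); first by apply/andP; lra.
  by rewrite /expi cx sx ger0_norm.
exists (- acos x + pi *+ 2); last first.
  by rewrite /expi cosD2pi sinD2pi cosN sinN cx sx ltr0_norm // opprK.
rewrite mulr2n.
have a0 : acos x != 0.
  by apply: contraTneq y0 => a0; move: sx; rewrite a0 sin0 => /esym /normr0_eq0 ->;
    rewrite ltxx.
have : 0 < acos x by rewrite lt_def a0.
by move=> ?; apply/andP; lra.
Qed.

(** [lebesgue_measure] is defined on all sets, as the outer measure generated by
    the lengths of half-open intervals. *)
Lemma null_set_cover (B : set R) (e : R) : lebesgue_measure B = 0%E -> 0 < e ->
  exists a b : nat -> R, [/\ forall i, a i <= b i,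
    B `<=` \bigcup_i `]a i, b i]%classic & forall n, \sum_(i < n) (b i - a i) <= e].
Proof.
move=> B0 e0.
have /ereal_inf_lt[_ [F [mF BF] <-] Fe] : (lebesgue_measure B < e%:E)%E.
  by rewrite B0 lte_fin.
have exab i : exists ab : R * R, ab.1 <= ab.2 /\ F i = `]ab.1, ab.2]%classic.
  have /ocitvP[->|[ab /ltW h ->]] := mF i; last by exists ab.
  by exists (0, 0); split => //=; rewrite set_itvoc0.
have [ab hab] := choice exab.
exists (fst \o ab), (snd \o ab); split => [i|x /BF[i _ Fx]|n].
- by case: (hab i).
- by have [_ FE] := hab i; exists i => //; rewrite FE in Fx.
rewrite -lee_fin; apply: le_trans (ltW Fe).
rewrite -sumEFin.
have lenF i : wlength idfun (F i) = ((ab i).2 - (ab i).1)%:E.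
  have [h ->] := hab i; rewrite wlength_itv_bnd //.
under eq_bigr do rewrite /= -lenF.
rewrite -(big_mkord xpredT (fun i => wlength idfun (F i))).
by apply: nneseries_lim_ge => i _ _; exact: wlength_ge0.
Qed.
End CircleCover.

(** * Spectral subspaces of small discs *)

Section BorelC.
Variable R : realType.

Lemma lipschitz_measurable (f : R[i] -> R) :
  (forall z w, `|f z - f w| <= normc (z - w)) ->
  measurable_fun [set: borelC R] (f : borelC R -> R).
Proof.
move=> lf; apply: (measurability _ (RGenOInfty.measurableE R)).
move=> /= _ [_ [a ->]] <-; rewrite setTI; apply: sub_sigma_algebra.
rewrite openE => z; rewrite /= in_itv /= andbT => az.
have e0 : 0 < (f z - a)%:C by rewrite ltcR subr_gt0.
apply/nbhs_ballP; exists (f z - a)%:C => //= w.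
rewrite -ball_normE /= normE_C ltcR in_itv /= andbT => zw.
by have := le_lt_trans (le_trans (ler_norm _) (lf z w)) zw; lra.
Qed.

Lemma measurable_Re :
  measurable_fun [set: borelC R] (@complex.Re R : borelC R -> R).
Proof.
apply: lipschitz_measurable => z w; rewrite -raddfB /=.
exact: Re_le_normc.
Qed.

Lemma measurable_Im :
  measurable_fun [set: borelC R] (@complex.Im R : borelC R -> R).
Proof.
apply: lipschitz_measurable => z w; rewrite -raddfB /=.
exact: Im_le_normc.
Qed.

Definition disc (c : R[i]) (d : R) : set (borelC R) :=
  [set z : R[i] | normc (z - c) <= d].

Lemma measurable_dist (c : R[i]) :
  measurable_fun [set: borelC R] ((fun z : R[i] => normc (z - c)) : borelC R -> R).
Proof.
apply: lipschitz_measurable => z w; rewrite ler_norml; apply/andP; split.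
  have -> : w - c = (z - c) - (z - w) by ring.
  have := le_normcD (z - c) (- (z - w)); rewrite normcN; lra.
have -> : z - c = (w - c) + (z - w) by ring.
have := le_normcD (w - c) (z - w); lra.
Qed.

Lemma measurable_disc c d : measurable (disc c d).
Proof.
rewrite -[disc c d]setTI.
have -> : disc c d = (fun z : R[i] => normc (z - c)) @^-1` `]-oo, d].
  by apply/seteqP; split => z; rewrite /disc /= in_itv.
exact: measurable_dist.
Qed.

Lemma measurable_circle : measurable (@circle R).
Proof.
rewrite -[@circle R]setTI.
have -> : @circle R = (fun z : R[i] => normc (z - 0)) @^-1` [set 1].
  apply/seteqP; split => z; rewrite /circle /= subr0 normE_C.
    by move=> /complexI.
  by move=> ->.
exact: measurable_dist.
Qed.
End BorelC.

Section Spectral.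
Variables (R : realType) (H : hilbertType R) (U : unitary H).
Variable P : spectral_measure H.
Implicit Types (S T : set (borelC R)) (x : H).

Lemma sproj_orth S : measurable S -> orth_proj (P S).
Proof.
move=> mS; split=> [x y|x]; first exact: sproj_selfadjoint.
by rewrite -sprojI // setIid.
Qed.

Lemma scalar_measure_nrm S x : measurable S ->
  scalar_measure P x S = (nrm (P S x) ^+ 2)%:E.
Proof.
move=> mS; have [PP Pid] := sproj_orth mS.
by rewrite scalar_measureE // -{1}Pid PP inner_nrm.
Qed.

Lemma sproj_set0 x : P set0 x = 0.
Proof.
have := scalar_measure_nrm x (@measurable0 _ (borelC R)).
rewrite measure0 => -[/esym/eqP]; rewrite sqrf_eq0 => /eqP; exact: nrm_eq0.
Qed.

Lemma sproj_disjoint S T x : measurable S -> measurable T -> S `&` T = set0 ->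
  P S (P T x) = 0.
Proof. by move=> mS mT ST; rewrite -sprojI // ST sproj_set0. Qed.

Lemma sprojT x : P setT x = x.
Proof.
rewrite -{1}[x](sproj_circle P) -sprojI ?setTI ?sproj_circle //.
exact: measurable_circle.
Qed.

Hypothesis UP : is_spectral_measure U P.

(** If [P S x = x], then the scalar measure of [x] is carried by the part of the
    circle in the disc.  There |z - c|^2 = 2 - 2 Re (z conj(c)) is at most d^2,
    and integrating gives |U x - c x|^2 = 2 |x|^2 - 2 Re <U x, c x> <= d^2 |x|^2. *)
Lemma disc_almost_scalar S c d : 0 <= d -> measurable S -> S `<=` disc c d ->
  normc c = 1 -> almost_scalar U (P S) c d.
Proof.
move=> d0 mS Sd c1; split=> // x Px.
have mC := @measurable_circle R.
set mu := scalar_measure P x.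
have muE A : measurable A -> mu A = (nrm (P A x) ^+ 2)%:E.
  by move=> mA; rewrite /mu scalar_measure_nrm.
have mufin A : measurable A -> (mu A < +oo)%E by move=> mA; rewrite muE ?ltry.
pose a := complex.Re c; pose b := complex.Im c.
pose f z := a * complex.Re z + b * complex.Im z.
have mf : measurable_fun [set: borelC R] (f : borelC R -> R).
  by apply: measurable_funD; apply: measurable_funM => //;
    [exact: measurable_Re|exact: measurable_Im].
have int_circle (g : borelC R -> R) A : measurable_fun setT g ->
    measurable A -> A `<=` @circle R ->
    (forall z : R[i], normc z = 1 -> `|g z| <= 2) -> mu.-integrable A (EFin \o g).
  move=> mg mA AC bg; apply: measurable_bounded_integrable => //.
  - exact: mufin.
  - exact: measurable_funTS.
  - exists 2; split=> // M M1 z /AC /complexI z1.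
    by apply: le_trans (bg z z1) (ltW M1).
have [a1 b1] : `|a| <= 1 /\ `|b| <= 1.
  by rewrite -c1; split; [exact: Re_le_normc|exact: Im_le_normc].
have f2 z : normc z = 1 -> `|f z| <= 2.
  move=> z1; apply: le_trans (ler_normD _ _) _; rewrite !normrM.
  have hR := Re_le_normc z; have hI := Im_le_normc z; rewrite z1 in hR hI.
  have := ler_pM (normr_ge0 _) (normr_ge0 _) a1 hR.
  have := ler_pM (normr_ge0 _) (normr_ge0 _) b1 hI; lra.
have nrm_CS : nrm (P (@circle R `&` S) x) = nrm x.
  by rewrite sprojI // Px sproj_circle.
have mCS : measurable (@circle R `&` S) by exact: measurableI.
have mCnS : measurable (@circle R `\` S) by exact: measurableD.
have muCnS : mu (@circle R `\` S) = 0%E.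
  rewrite muE // -{1}Px sproj_disjoint ?nrm0 ?expr0n //.
  by rewrite setDE -setIA setICl setI0.
have null : \int[mu]_(z in @circle R `\` S) f z = 0.
  rewrite /Rintegral null_set_integral //; apply/measurable_EFinP.
  exact: measurable_funTS.
have lower : (1 - d ^+ 2 / 2) * nrm x ^+ 2 <=
    \int[mu]_(z in @circle R `&` S) f z.
  rewrite -[X in _ * X](_ : fine (mu (@circle R `&` S)) = _); last first.
    by rewrite muE // nrm_CS.
  rewrite -Rintegral_cst //; apply: le_Rintegral => //.
  - apply: measurable_bounded_integrable => //; first exact: mufin.
    exact: bounded_cst.
  - by apply: int_circle.
  - move=> z [/complexI z1 /Sd]; rewrite /disc /= => zd.
    have : normc (z - c) ^+ 2 <= d ^+ 2 by rewrite ler_sqr ?nnegrE ?normc_ge0.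
    have z2 : normc z ^+ 2 = 1 by rewrite z1 expr1n.
    have c2 : normc c ^+ 2 = 1 by rewrite c1 expr1n.
    move: z2 c2; rewrite /f /a /b.
    case: (z) (c) => [p q] [p' q'] /=.
    rewrite !sqr_sqrtr ?addr_ge0 ?sqr_ge0 //; lra.
have fE : complex.Re '[U x, c *: x] = \int[mu]_(z in @circle R) f z.
  have iRe : mu.-integrable (@circle R) (EFin \o (@complex.Re R : borelC R -> R)).
    apply: int_circle => //; first exact: measurable_Re.
    by move=> z z1; have := Re_le_normc z; rewrite z1; lra.
  have iIm : mu.-integrable (@circle R) (EFin \o (@complex.Im R : borelC R -> R)).
    apply: int_circle => //; first exact: measurable_Im.
    by move=> z z1; have := Im_le_normc z; rewrite z1; lra.
  rewrite innerZr UP /f RintegralD //.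
  - rewrite !RintegralZl // -/mu /a /b.
    by case: (c) => p q /=; ring.
  - have := @integrableZl _ _ _ mu _ mC a _ iRe; apply: eq_integrable => //.
  - have := @integrableZl _ _ _ mu _ mC b _ iIm; apply: eq_integrable => //.
have split_f : \int[mu]_(z in @circle R) f z =
   \int[mu]_(z in @circle R `&` S) f z + \int[mu]_(z in @circle R `\` S) f z.
  rewrite -Rintegral_setU // ?setUIDK //.
    by apply: int_circle.
  apply/disj_setPS => z [[_ Sz] [_ nSz]]; exact: nSz.
rewrite -ler_sqr ?nnegrE ?nrm_ge0 ?mulr_ge0 ?nrm_ge0 //.
rewrite nrmB2 nrmZ c1 nrm_unitary fE split_f null exprMn; lra.
Qed.
End Spectral.

(** * Singular unitary operators are nearly diagonal *)

Section SingularUnitary.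
Variables (R : realType) (H : hilbertType R) (U : unitary H).

Lemma lebesgue_null_bigcup (F : nat -> set R) :
  (forall k, lebesgue_measure (F k) = 0%E) ->
  lebesgue_measure (\bigcup_k F k) = 0%E.
Proof.
move=> F0; apply/eqP; rewrite eq_le measure_ge0 andbT.
apply: le_trans (outer_measure_sigma_subadditive
  ((wlength idfun)^*)%mu F) _.
by rewrite eseries0 // => k _ _; exact: F0.
Qed.

Lemma nrm_sub_proj (n : nat) (P : 'I_n -> H -> H) (v : H) :
  (forall i, orth_proj (P i)) ->
  (forall i j, i != j -> P i (P j v) = 0) ->
  nrm (v - \sum_i P i v) ^+ 2 = nrm v ^+ 2 - \sum_i nrm (P i v) ^+ 2.
Proof.
move=> oP dP.
have Pv i : '[v, P i v] = (nrm (P i v) ^+ 2)%:C.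
  by have [PP Pid] := oP i; rewrite -inner_nrm PP Pid.
have vw : '[v, \sum_i P i v] = (\sum_i nrm (P i v) ^+ 2)%:C.
  by rewrite inner_sumr rmorph_sum /=; apply: eq_bigr => i _.
have ww : '[\sum_i P i v, \sum_i P i v] = (\sum_i nrm (P i v) ^+ 2)%:C.
  rewrite inner_suml rmorph_sum /=; apply: eq_bigr => i _.
  rewrite inner_sumr (bigD1 i) //= inner_nrm big1 ?addr0 // => j ji.
  by have [PP _] := oP j; rewrite -PP dP // inner0l.
rewrite nrmB2 vw; move: ww; rewrite inner_nrm => /complexI ->.
by rewrite /=; ring.
Qed.

(** The scalar measures of finitely many vectors are carried by one null set.
    Cover it by discs of small total radius, make the discs disjoint, and keep so
    many of them that little of each measure is left out. *)
Lemma singular_nearly_diagonal : singular_unitary U -> nearly_diagonal U.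
Proof.
move=> [P UP sP] r v e e0.
have /choice[N hN] : forall k, exists N, measurable N /\
    (arc_length N = 0%E /\ scalar_measure P (v k) (~` N) = 0%E).
  by move=> k; have [N mN h] := sP (v k); exists N.
pose B (N : set (borelC R)) : set R := [set t | 0 <= t < 2 * pi] `&` [set t | N (expi t)].
pose F (k : nat) := if insub k is Some k' then B (N k') else set0.
have F0 k : lebesgue_measure (F k) = 0%E.
  rewrite /F; case: insub => [k'|]; last exact: measure0.
  by have [_ [h _]] := hN k'; exact: h.
have e2 : 0 < e / 2 by rewrite divr_gt0.
have [a [b [ab FU sab]]] := null_set_cover (lebesgue_null_bigcup F0) e2.
(* The parametrization of the circle is 2-Lipschitz, hence the factor 2. *)
pose J i := disc (expi (a i)) (2 * (b i - a i)).
have mJ i : measurable (J i) by exact: measurable_disc.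
pose S := seqDU J.
have mS i : measurable (S i).
  by apply: measurableD => //; apply: bigsetU_measurable.
have SJ i : S i `<=` J i by move=> z [].
have triv := @trivIset_seqDU _ J.
have null k : scalar_measure P (v k) (~` \bigcup_i S i) = 0%E.
  have [mN [_ N0]] := hN k.
  apply/eqP; rewrite eq_le measure_ge0 andbT.
  apply: le_trans (_ : scalar_measure P (v k) (~` N k `|` ~` @circle R) <= _)%E.
    apply: le_measure; rewrite ?inE.
    - by apply: measurableC; apply: bigcup_measurable.
    - by apply: measurableU; apply: measurableC => //; exact: measurable_circle.
    - rewrite -seqDU_bigcup_eq -setCI; apply: subsetC => z [Nz /complexI z1].
      have [t ht zt] := expi_surj z1.
      have [i _ /= /[!in_itv] /= /andP[at_ tb]] : (\bigcup_i `]a i, b i]%classic) t.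
        apply: FU; exists k => //=; rewrite /F insubT //= => kr.
        rewrite (_ : Sub _ _ = k); last exact: val_inj.
        by rewrite zt in Nz; split.
      exists i => //; rewrite /J /disc /= zt.
      apply: le_trans (lipschitz_expi _ _) _.
      rewrite ger0_norm; lra.
  have mC : measurable (~` @circle R).
    by apply: measurableC; exact: measurable_circle.
  have C0 : scalar_measure P (v k) (~` @circle R) = 0%E.
    rewrite scalar_measure_nrm // -(sproj_circle P (v k)) sproj_disjoint //.
    - by rewrite nrm0 expr0n.
    - exact: measurable_circle.
    - by rewrite setICl.
  apply: le_trans (measureU2 _ _ _) _ => //; first exact: measurableC.
  by rewrite -[leRHS]adde0; apply: leeD; [rewrite -N0|rewrite -C0].
have approx k : exists n, forall m, (n <= m)%N ->
    nrm (v k) ^+ 2 - e ^+ 2 < \sum_(i < m) nrm (P (S i) (v k)) ^+ 2.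
  have mU : measurable (\bigcup_i S i) by apply: bigcup_measurable.
  have muU : scalar_measure P (v k) (\bigcup_i S i) = (nrm (v k) ^+ 2)%:E.
    rewrite -{2}[v k](sprojT P) -scalar_measure_nrm // -(setUv (\bigcup_i S i)).
    by rewrite measureU0 //; exact: measurableC.
  have := @measure_semi_sigma_additive _ _ _ (scalar_measure P (v k)) _ mS triv mU.
  rewrite muU => cvS.
  have h : ((nrm (v k) ^+ 2 - e ^+ 2)%:E < (nrm (v k) ^+ 2)%:E)%E.
    by rewrite lte_fin gtrBl exprn_gt0.
  have [n _ hn] := cvS _ (open_ereal_gt_ereal h).
  exists n => m nm; have := hn m nm; rewrite /= big_mkord => hm.
  rewrite -lte_fin -sumEFin; apply: lt_le_trans hm _.
  by apply: lee_sum => i _; rewrite -scalar_measure_nrm.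
have [n hn] := choice approx.
pose m := \max_k n k.
have d0 i : 0 <= 2 * (b i - a i) by rewrite mulr_ge0 // subr_ge0.
exists m, (fun i : 'I_m => P (S i)), (fun i : 'I_m => expi (a i)),
  (fun i : 'I_m => 2 * (b i - a i)).
split=> [i|i|i||k].
- exact: sproj_orth.
- by apply: (disc_almost_scalar UP (d0 i) (mS i) (SJ i)); exact: normc_expi.
- exact: d0.
- by rewrite -mulr_sumr; have := sab m; lra.
- rewrite -ler_sqr ?nnegrE ?nrm_ge0 ?(ltW e0) //.
  rewrite (@nrm_sub_proj _ (fun i : 'I_m => P (S i))).
  + have := hn k m (leq_bigmax k); lra.
  + by move=> i; apply: sproj_orth.
  + move=> i j ij; apply: sproj_disjoint => //.
    by have /trivIsetP := triv; apply.
Qed.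
End SingularUnitary.

(** * Banach limits *)

Section BanachLimits.
Variable R : realType.

Definition bounded_seq (c : nat -> R) := exists B, forall n, `|c n| <= B.

Definition linear_on_bounded (L : (nat -> R) -> R) :=
  forall k c d, bounded_seq c -> bounded_seq d ->
    L (fun n => k * c n + d n) = k * L c + L d.

Record banach_limit (L : (nat -> R) -> R) : Prop := BanachLimit {
  banach_limitP : linear_on_bounded L ;
  banach_limit_le : forall B c, (forall n, `|c n| <= B) -> `|L c| <= B ;
  banach_limit_shift : forall c, bounded_seq c -> L (fun n => c n.+1) = L c }.

Definition bounded_cseq (c : nat -> R[i]) := exists B, forall n, normc (c n) <= B.

Definition complexify (L : (nat -> R) -> R) (c : nat -> R[i]) : R[i] :=
  L (fun n => complex.Re (c n)) +i* L (fun n => complex.Im (c n)).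

Section Linear.
Variable L : (nat -> R) -> R.
Hypothesis linL : linear_on_bounded L.
Local Notation LC := (complexify L).

Lemma bounded_cseqRe c : bounded_cseq c -> bounded_seq (fun n => complex.Re (c n)).
Proof. by case=> B hB; exists B => n; apply: le_trans (Re_le_normc _) (hB n). Qed.

Lemma bounded_cseqIm c : bounded_cseq c -> bounded_seq (fun n => complex.Im (c n)).
Proof. by case=> B hB; exists B => n; apply: le_trans (Im_le_normc _) (hB n). Qed.

Lemma bounded_seqP k c d : bounded_seq c -> bounded_seq d ->
  bounded_seq (fun n => k * c n + d n).
Proof.
move=> [B hB] [B' hB']; exists (`|k| * B + B') => n.
apply: le_trans (ler_normD _ _) _; rewrite normrM.
by rewrite lerD // ler_wpM2l.
Qed.

Lemma complexifyP k c d : bounded_cseq c -> bounded_cseq d ->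
  LC (fun n => k * c n + d n) = k * LC c + LC d.
Proof.
move=> bc bd.
have [cR cI] := (bounded_cseqRe bc, bounded_cseqIm bc).
have [dR dI] := (bounded_cseqRe bd, bounded_cseqIm bd).
rewrite /complexify.
have -> : (fun n => complex.Re (k * c n + d n)) = (fun n =>
    complex.Re k * complex.Re (c n) +
      (- complex.Im k * complex.Im (c n) + complex.Re (d n))).
  by apply/funext => n; case: (k) (c n) (d n) => [a b] [a' b'] [a'' b''] /=; ring.
have -> : (fun n => complex.Im (k * c n + d n)) = (fun n =>
    complex.Re k * complex.Im (c n) +
      (complex.Im k * complex.Re (c n) + complex.Im (d n))).
  by apply/funext => n; case: (k) (c n) (d n) => [a b] [a' b'] [a'' b''] /=; ring.
rewrite !linL //; try exact: bounded_seqP.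
case: (k) => a b /=; apply/eqP; rewrite eq_complex /=.
by apply/andP; split; apply/eqP; ring.
Qed.

Lemma complexifyD c d : bounded_cseq c -> bounded_cseq d ->
  LC (fun n => c n + d n) = LC c + LC d.
Proof.
move=> bc bd; have := complexifyP 1 bc bd; rewrite mul1r => <-.
by congr LC; apply/funext => n; rewrite mul1r.
Qed.

Lemma complexifyB c d : bounded_cseq c -> bounded_cseq d ->
  LC (fun n => c n - d n) = LC c - LC d.
Proof.
move=> bc bd; have := complexifyP (- 1) bd bc; rewrite mulN1r addrC => <-.
by congr LC; apply/funext => n; rewrite mulN1r addrC.
Qed.

End Linear.

Variable L : (nat -> R) -> R.
Hypothesis hL : banach_limit L.
Local Notation LC := (complexify L).

Lemma complexify_le B c : (forall n, normc (c n) <= B) -> normc (LC c) <= 2 * B.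
Proof.
move=> hB; apply: le_trans (normc_le_ReIm _) _; rewrite mulrDl mul1r /=.
by apply: lerD; apply: (banach_limit_le hL) => n;
  [apply: le_trans (Re_le_normc _) _|apply: le_trans (Im_le_normc _) _].
Qed.

Lemma complexify0 : LC (fun=> 0) = 0.
Proof.
apply: eq0_normc; apply/eqP; rewrite eq_le normc_ge0 andbT -[leRHS](mulr0 2).
by apply: complexify_le => n; rewrite normc0.
Qed.

Lemma complexify_shift c : bounded_cseq c -> LC (fun n => c n.+1) = LC c.
Proof.
move=> bc; rewrite /complexify.
by rewrite (banach_limit_shift hL (bounded_cseqRe bc))
  (banach_limit_shift hL (bounded_cseqIm bc)).
Qed.
End BanachLimits.

(** * Traceless matrices of size two *)

Section TracelessMatrices.
Variable F : comNzRingType.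

Lemma tr_mx2 (X : 'M[F]_2) : \tr X = X 0 0 + X 1 1.
Proof.
rewrite /mxtrace !big_ord_recl big_ord0 addr0.
by congr (_ + X _ _); apply: val_inj.
Qed.

(** Polarization of the Cayley-Hamilton identity X^2 = - det X for a traceless
    matrix of size two. *)
Lemma anticommutator_traceless (X Y : 'M[F]_2) : \tr X = 0 -> \tr Y = 0 ->
  exists q, X *m Y + Y *m X = q%:M.
Proof.
rewrite !tr_mx2 => /eqP; rewrite addr_eq0 => /eqP X0 /eqP.
rewrite addr_eq0 => /eqP Y0.
exists ((X *m Y + Y *m X) 0 0); apply/matrixP => k l; rewrite !mxE.
have two (f : 'I_2 -> F) : \sum_i f i = f 0 + f 1.
  by rewrite !big_ord_recl big_ord0 addr0; congr (_ + f _); apply: val_inj.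
have ord2 (i : 'I_2) : i = 0 \/ i = 1.
  by case: i => [[|[|//]] ?]; [left|right]; apply: val_inj.
rewrite !two.
by have [->|->] := ord2 k; have [->|->] := ord2 l;
  rewrite ?eqxx /= ?mulr1n ?mulr0n ?X0 ?Y0; ring.
Qed.
End TracelessMatrices.

(** * The Banach limit of the wave operators *)

Section Intertwining.
Variables (R : realType) (H1 H2 : hilbertType R).
Variables (U1 : unitary H1) (U2 : unitary H2).

Definition intertwines (H H' : hilbertType R) (U : unitary H) (V : unitary H')
  (f : H -> H') := forall x, f (U x) = V (f x).

Lemma intertwines_upow (f : H1 -> H2) : intertwines U1 U2 f ->
  forall m x, f (upow U1 m x) = upow U2 m (f x).
Proof.
move=> fU; have fV x : f (uinv U1 x) = uinv U2 (f x).
  by apply: (can_inj (uopK U2)); rewrite uinvK -fU uinvK.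
elim/int_rec=> [//|m IH|m IH] x.
  by rewrite intS addrC !upowS fU IH.
by rewrite intS opprD addrC !upowB fV IH.
Qed.

Lemma intertwines_adjoint (f : H1 -> H2) g : adjoint_pair f g ->
  intertwines U1 U2 f -> intertwines U2 U1 g.
Proof.
move=> fg fU y; apply: inner_extr => x.
rewrite -fg -{1}[x](uinvK U1) fU uop_inner fg.
by rewrite -{2}[x](uinvK U1) uop_inner.
Qed.

Lemma upow_linear m : linear (upow U1 m).
Proof. exact: adjoint_linear (upow_adjoint U1 m). Qed.

End Intertwining.

Section WaveDifference.
Variables (R : realType) (H1 H2 : hilbertType R).
Variables (U1 : unitary H1) (U2 : unitary H2).
Variables (A : {linear H1 -> H2}) (A' : H2 -> H1) (M : R).
Hypotheses (M0 : 0 <= M) (bA : opbound M A) (AA' : adjoint_pair A A').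

Definition wave (x : H1) (y : H2) (m : int) := '[A (upow U1 m x), upow U2 m y].

Definition wave_diff x y (n : nat) := wave x y n%:Z - wave x y (- n%:Z).

Lemma wave_le x y m : normc (wave x y m) <= M * nrm x * nrm y.
Proof.
apply: le_trans (cauchy_schwarz _ _) _.
rewrite nrm_upow ler_wpM2r ?nrm_ge0 //.
by apply: le_trans (bA _) _; rewrite nrm_upow.
Qed.

Lemma bounded_wave x y (f : nat -> int) : bounded_cseq (fun n => wave x y (f n)).
Proof. by exists (M * nrm x * nrm y) => n; apply: wave_le. Qed.

Lemma wave_diff_le x y n : normc (wave_diff x y n) <= 2 * M * nrm x * nrm y.
Proof.
apply: le_trans (le_normcD _ _) _; rewrite normcN.
have := wave_le x y n%:Z; have := wave_le x y (- n%:Z); lra.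
Qed.

Lemma bounded_wave_diff x y : bounded_cseq (wave_diff x y).
Proof. by exists (2 * M * nrm x * nrm y) => n; apply: wave_diff_le. Qed.

Lemma wavePl a x y z m : wave (a *: x + y) z m = a * wave x z m + wave y z m.
Proof. by rewrite /wave upow_linear linearP innerDl innerZl. Qed.

Lemma wavePr a x y z m :
  wave z (a *: x + y) m = conjc a * wave z x m + wave z y m.
Proof. by rewrite /wave upow_linear innerDr innerZr. Qed.

Lemma wave_unitary x y m : wave (U1 x) (U2 y) m = wave x y (m + 1).
Proof. by rewrite /wave !upowD. Qed.

Variables (r : nat) (u : 'I_r -> H1) (v : 'I_r -> H2).
Hypothesis commE : forall x, A (U1 x) - U2 (A x) = \sum_k '[x, u k] *: v k.

(** The increment from [wave x y j] to [wave x y (j + 1)]. *)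
Definition wave_jump x y (j : int) :=
  \sum_k '[upow U1 j x, u k] * '[v k, upow U2 (j + 1) y].

(** The indices j and - 1 - j are paired, because reversing the order of the
    summation over - n <= j < n exchanges them. *)
Lemma wave_diffE x y n :
  wave_diff x y n = \sum_(j < n) (wave_jump x y j%:Z + wave_jump x y (- 1 - j%:Z)).
Proof.
have step m : wave x y (m + 1) = wave x y m + wave_jump x y m.
  have -> : wave_jump x y m =
      '[A (U1 (upow U1 m x)) - U2 (A (upow U1 m x)), upow U2 (m + 1) y].
    by rewrite commE inner_suml; apply: eq_bigr => k _; rewrite innerZl.
  by rewrite innerBl /wave !upowS uop_inner addrC subrK.
elim: n => [|n IH]; first by rewrite big_ord0 /wave_diff subrr.
rewrite big_ord_recr /= -IH /wave_diff -[n.+1]addn1 PoszD step.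
have := step (- 1 - n%:Z); rewrite addrAC addNr add0r => ->.
by rewrite opprD (addrC (- n%:Z)); ring.
Qed.

Variables (L : (nat -> R) -> R).
Hypothesis hL : banach_limit L.
Local Notation LC := (complexify L).

(** [wave (U1 x) (U2 y)] is a shift of [wave x y], so the intertwining relation
    is the shift invariance of [L].  On the negative indices the shift goes the
    other way, hence [complexify_shift] is used on the other side. *)
Lemma wave_limit_op : exists D D', [/\ forall x y, LC (wave_diff x y) = '[D x, y],
  adjoint_pair D D', opbound (2 * (2 * M)) D, opbound (2 * (2 * M)) D' &
  intertwines U1 U2 D].
Proof.
have [||||D [D' [DE DD' bD bD']]] :=
    @sesquilinear_riesz _ _ _ (fun x y => LC (wave_diff x y)) (2 * (2 * M)).
- move=> a x y z; rewrite -(complexifyP (banach_limitP hL)) //;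
    try exact: bounded_wave_diff.
  congr LC; apply/funext => n; rewrite /wave_diff !wavePl; ring.
- move=> a x y z; rewrite -(complexifyP (banach_limitP hL)) //;
    try exact: bounded_wave_diff.
  congr LC; apply/funext => n; rewrite /wave_diff !wavePr; ring.
- by rewrite !mulr_ge0.
- move=> x y; rewrite -!mulrA; apply: (complexify_le hL) => n.
  by rewrite !mulrA; apply: wave_diff_le.
exists D, D'; split=> // x; apply: inner_ext => y.
rewrite -[y](uinvK U2) uop_inner -!DE.
move: (uinv U2 y) => {}y.
rewrite /wave_diff !(complexifyB (banach_limitP hL)) //; try exact: bounded_wave.
congr (_ - _).
  rewrite -[RHS](complexify_shift hL); last exact: bounded_wave.
  by congr LC; apply/funext => n; rewrite wave_unitary -[n.+1]addn1.
rewrite -[LHS](complexify_shift hL); last exact: bounded_wave.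
congr LC; apply/funext => n.
by rewrite wave_unitary -[n.+1]addn1 PoszD opprD subrK.
Qed.

End WaveDifference.

(** * Rank two: the Banach limit vanishes *)

Section WaveLimit.
Variables (R : realType) (H1 H2 : hilbertType R).
Variables (U1 : unitary H1) (U2 : unitary H2).
Variables (A : {linear H1 -> H2}) (A' : H2 -> H1) (M : R).
Hypotheses (M0 : 0 <= M) (bA : opbound M A) (AA' : adjoint_pair A A').
Variables (u : 'I_2 -> H1) (v : 'I_2 -> H2).
Hypothesis commE : forall x, A (U1 x) - U2 (A x) = \sum_k '[x, u k] *: v k.
Hypothesis tU1 : nearly_diagonal U1.
Variables (L : (nat -> R) -> R).
Hypothesis hL : banach_limit L.
Local Notation LC := (complexify L).
Local Notation W := (wave_diff U1 U2 A).

(** The operator [T \o A] has the commutator [sum_k <., u k> T (v k)] with [U1]. *)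
Lemma trace_intertwiner (T : H2 -> H1) T' N : 0 <= N ->
  adjoint_pair T T' -> opbound N T -> intertwines U2 U1 T ->
  \sum_k '[T (v k), u k] = 0.
Proof.
move=> N0 TT' bT TU.
apply: (@trace_commutator_eq0 _ _ U1 _ u (T \o v) (T \o A) (A' \o T') (N * M)) => //.
- by rewrite mulr_ge0.
- exact: adjoint_comp.
- exact: opbound_comp.
- move=> x; apply: inner_ext => z /=.
  rewrite innerBl -TU !TT' -innerBl commE !inner_suml.
  by apply: eq_bigr => k _; rewrite !innerZl TT'.
Qed.

Variables (D : H1 -> H2) (D' : H2 -> H1) (N : R).
Hypotheses (N0 : 0 <= N) (DE : forall x y, LC (W x y) = '[D x, y])
  (DD' : adjoint_pair D D') (bD : opbound N D) (bD' : opbound N D')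
  (DU : intertwines U1 U2 D).

Let D'U : intertwines U2 U1 D' := intertwines_adjoint DD' DU.

Definition coef (j : int) : 'M[R[i]]_2 :=
  \matrix_(k, l) '[upow U1 j (D' (v l)), u k].

Lemma tr_coef j : \tr (coef j) = 0.
Proof.
rewrite /mxtrace; under eq_bigr do rewrite mxE.
apply: (@trace_intertwiner (upow U1 j \o D') (D \o upow U1 (- j)) (1 * N)).
- by rewrite mul1r.
- by apply: adjoint_comp; [exact: adjointC|exact: upow_adjoint].
- by apply: opbound_comp => // x; rewrite nrm_upow mul1r.
- by move=> y /=; rewrite D'U -[U1 (D' y)]/(upow U1 1 _) -upowD upowS.
Qed.

Let G y := D' (D (D' y)).

Lemma tr_cubic s : \sum_k '[upow U1 s (G (v k)), u k] = 0.
Proof.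
pose T1 := upow U1 s \o D'.
have aT1 : adjoint_pair T1 (D \o upow U1 (- s)).
  by apply: adjoint_comp; [exact: adjointC|exact: upow_adjoint].
apply: (@trace_intertwiner (T1 \o (D \o D')) ((D \o D') \o (D \o upow U1 (- s)))
  (1 * N * (N * N))).
- by rewrite mul1r !mulr_ge0.
- by apply: adjoint_comp aT1; apply: adjoint_comp DD'; exact: adjointC.
- apply: opbound_comp; rewrite ?mul1r //; first exact: opbound_comp.
  by move=> x; rewrite /T1 /= nrm_upow.
- move=> y; rewrite /T1 /= D'U DU D'U.
  by rewrite -[U1 (D' _)]/(upow U1 1 _) -upowD upowS.
Qed.

Lemma coef_inner j k i : '[v i, upow U2 j (D (u k))] = coef (- j) k i.
Proof.
by rewrite mxE -(intertwines_upow DU) -(adjointC DD') upow_adjoint opprK.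
Qed.

Lemma wave_jump_left s j k l :
  wave_jump U1 U2 u v (upow U1 s (D' (v l))) (D (u k)) j =
  (coef (- 1 - j) *m coef (s + j)) k l.
Proof.
rewrite !mxE; apply: eq_bigr => i _.
by rewrite coef_inner !mxE -upowD mulrC opprD addrC (addrC j).
Qed.

Lemma wave_jump_right s j k l :
  wave_jump U1 U2 u v (D' (v l)) (D (upow U1 (- s) (u k))) j =
  (coef (s - 1 - j) *m coef j) k l.
Proof.
rewrite !mxE; apply: eq_bigr => i _.
rewrite (intertwines_upow DU) -upowD coef_inner !mxE mulrC.
by have -> : - (j + 1 - s) = s - 1 - j by ring.
Qed.

(** The number is computed as <D x_l, y_k> for two pairs of families: the power
    U1^s is attached to x_l in the first and to y_k in the second.  The two
    telescoping sums consist of products of the same matrices [coef] in opposite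
    orders, so together they give anticommutators. *)
Lemma cubic_coef_eq0 s k l : '[upow U1 s (G (v l)), u k] = 0.
Proof.
pose x i := upow U1 s (D' (v i)); pose y i := D (u i).
pose x' i := D' (v i); pose y' i := D (upow U1 (- s) (u i)).
have bW := bounded_wave_diff U1 U2 bA.
have gE i j : 2 * '[upow U1 s (G (v j)), u i] =
    LC (fun n => W (x j) (y i) n + W (x' j) (y' i) n).
  rewrite (complexifyD (banach_limitP hL)) // !DE /x /y /x' /y' /G mulrDl mul1r.
  congr (_ + _).
    by rewrite -(adjointC DD') (intertwines_upow DU) (intertwines_upow D'U).
  by rewrite -(adjointC DD') upow_adjoint.
have /choice[q hq] : forall n, exists c : R[i], forall i j,
    W (x j) (y i) n + W (x' j) (y' i) n = c%:M i j.
  move=> n.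
  pose X j := coef (- 1 - j%:Z) *m coef (s + j%:Z) + coef (s + j%:Z) *m coef (- 1 - j%:Z).
  pose Y j := coef j%:Z *m coef (s - 1 - j%:Z) + coef (s - 1 - j%:Z) *m coef j%:Z.
  have scal (m : nat) : exists c, \sum_(j < m) (X j + Y j) = c%:M.
    elim: m => [|m [c IH]].
      by exists 0; rewrite big_ord0 raddf0.
    have [a Xa] := anticommutator_traceless (tr_coef (- 1 - m%:Z)) (tr_coef (s + m%:Z)).
    have [b Yb] := anticommutator_traceless (tr_coef m%:Z) (tr_coef (s - 1 - m%:Z)).
    exists (c + (a + b)); rewrite big_ord_recr /= IH /X /Y Xa Yb.
    by rewrite !raddfD.
  have [c hc] := scal n; exists c => k' l'.
  rewrite -hc summxE !(wave_diffE commE) -big_split /=; apply: eq_bigr => j _.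
  rewrite !wave_jump_left !wave_jump_right /X /Y !mxE.
  (* The term j of one sum pairs with the term - 1 - j of the other. *)
  have -> : - 1 - (- 1 - j%:Z) = j%:Z by ring.
  have -> : s - 1 - (- 1 - j%:Z) = s + j%:Z by ring.
  have -> : s + (- 1 - j%:Z) = s - 1 - j%:Z by ring.
  by rewrite !addrA; ring.
have off : k != l -> 2 * '[upow U1 s (G (v l)), u k] = 0.
  move=> kl; rewrite gE -[RHS](complexify0 hL); congr LC.
  by apply/funext => n; rewrite hq mxE (negPf kl).
have diag i : 2 * '[upow U1 s (G (v i)), u i] = LC q.
  by rewrite gE; congr LC; apply/funext => n; rewrite hq mxE eqxx.
have two0 : (2 : R[i]) != 0 by rewrite pnatr_eq0.
apply: (mulfI two0); rewrite mulr0.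
have [->|] := eqVneq k l; last exact: off.
have := tr_cubic s => /(congr1 (fun z => 2 * z)).
rewrite mulr_sumr mulr0; under eq_bigr do rewrite diag.
rewrite sumr_const card_ord => q0.
by rewrite diag; apply: (mulfI two0); rewrite mulr0 -q0 mulr_natl.
Qed.

(** Each jump contains a factor <U1^j x, u_k>.  These factors vanish at
    x = D* D D* v_l, so D D* D D* v_l = 0, and positivity removes one factor of
    D or D* at a time until D* v_l = 0.  The jumps also contain a factor
    <v_k, U2^(j+1) y>, which vanishes when y is in the range of D. *)
Lemma wave_limit_eq0 x y : LC (W x y) = 0.
Proof.
have jump0 z y' : (forall j k, '[upow U1 j z, u k] = 0) -> '[D z, y'] = 0.
  move=> z0; rewrite -DE -[RHS](complexify0 hL); congr LC; apply/funext => n.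
  rewrite (wave_diffE commE) big1 // => j _.
  by rewrite /wave_jump !big1 ?addr0 // => k _; rewrite z0 mul0r.
have DG l : D (G (v l)) = 0.
  by apply: inner_ext => z; rewrite inner0l jump0 // => j k; exact: cubic_coef_eq0.
have G0 l : G (v l) = 0.
  by apply: inner_eq0; rewrite {1}/G (adjointC DD') DG inner0r.
have DD'v l : D (D' (v l)) = 0.
  by apply: inner_eq0; rewrite DD' -/(G _) G0 inner0r.
have D'v l : D' (v l) = 0.
  by apply: inner_eq0; rewrite (adjointC DD') DD'v inner0r.
rewrite DE (_ : D x = 0) ?inner0l //; apply: inner_eq0.
rewrite -DE -[RHS](complexify0 hL); congr LC; apply/funext => n.
rewrite (wave_diffE commE) big1 // => j _.
have J0 m : wave_jump U1 U2 u v x (D x) m = 0.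
  rewrite /wave_jump big1 // => k _.
  by rewrite -(intertwines_upow DU) -(adjointC DD') D'v inner0l mulr0.
by rewrite !J0 addr0.
Qed.
End WaveLimit.

(** * Weighted means of bounded sequences *)

Section WeightedMean.
Variables (R : realType) (q : nat -> R).
Hypotheses (q0 : forall n, 0 <= q n) (q1 : forall N, \sum_(i < N) q i <= 1).

Definition mean (c : nat -> R) : R := limn (series (fun n => q n * c n)).

Lemma cvg_weights : cvgn (series q).
Proof.
apply: nondecreasing_is_cvgn; first exact: nondecreasing_series.
by exists 1 => _ [N _ <-]; rewrite /series /= big_mkord.
Qed.

Lemma partial_mean_le (c : nat -> R) B N : (forall n, `|c n| <= B) ->
  `|\sum_(i < N) q i * c i| <= B.
Proof.
move=> hB; apply: le_trans (ler_norm_sum _ _ _) _.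
have B0 : 0 <= B by apply: le_trans (hB 0%N).
apply: le_trans (_ : \sum_(i < N) q i * B <= _).
  by apply: ler_sum => i _; rewrite normrM ger0_norm // ler_wpM2l.
by rewrite -mulr_suml ler_piMl.
Qed.

Lemma is_cvg_mean c : bounded_seq c -> cvgn (series (fun n => q n * c n)).
Proof.
move=> [B hB]; apply: normed_cvg; apply: nondecreasing_is_cvgn.
  exact: (@nondecreasing_series _ (fun n => `|q n * c n|)).
exists B => _ [N _ <-]; rewrite /= /series /= big_mkord.
apply: le_trans (ler_norm _) _.
under eq_bigr do rewrite normrM ger0_norm //.
by apply: (@partial_mean_le (fun n => `|c n|)) => n; rewrite normr_id.
Qed.

Lemma mean_linear : linear_on_bounded mean.
Proof.
move=> k c d bc bd; apply: cvg_lim => //.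
have -> : series (fun n => q n * (k * c n + d n)) =
   (fun N => k * series (fun n => q n * c n) N + series (fun n => q n * d n) N).
  apply/funext => N; rewrite /series /= mulr_sumr -big_split /=.
  by apply: eq_bigr => i _; ring.
by apply: cvgD; [apply: cvgMr|]; exact: is_cvg_mean.
Qed.

Lemma normr_lim_le (f : nat -> R) B : cvgn f -> (forall n, `|f n| <= B) -> `|limn f| <= B.
Proof.
move=> cf hf; rewrite ler_norml; apply/andP; split.
  apply: limr_ge => //; apply: nearW => n.
  by have := hf n; rewrite ler_norml => /andP[].
apply: limr_le => //; apply: nearW => n.
by have := hf n; rewrite ler_norml => /andP[].
Qed.

Lemma mean_le c B : (forall n, `|c n| <= B) -> `|mean c| <= B.
Proof.
move=> hB; apply: normr_lim_le => [|N]; first by apply: is_cvg_mean; exists B.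
by rewrite /series /= big_mkord; apply: partial_mean_le.
Qed.

(** Summation by parts. *)
Lemma mean_shift_le (c : nat -> R) B v : (forall n, `|c n| <= B) ->
  (forall N, \sum_(i < N) `|q i - q i.+1| <= v) ->
  `|mean (fun n => c n.+1) - mean c| <= 2 * B * (q 0%N + v).
Proof.
move=> hB hv.
have bc : bounded_seq c by exists B.
have bc' : bounded_seq (fun n => c n.+1) by exists B.
have -> : mean (fun n => c n.+1) - mean c = mean (fun n => -1 * c n + c n.+1).
  by rewrite mean_linear //; ring.
have B0 : 0 <= B by apply: le_trans (hB 0%N).
apply: normr_lim_le => [|N].
  by apply: is_cvg_mean; exact: bounded_seqP.
have abel : \sum_(i < N) q i * (-1 * c i + c i.+1) =
    q N * c N - q 0%N * c 0%N + \sum_(i < N) (q i - q i.+1) * c i.+1.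
  elim: N => [|N IH]; first by rewrite !big_ord0; ring.
  by rewrite !big_ord_recr /= IH; ring.
(* This bounds the boundary term: q_N - q_0 is a telescoping sum. *)
have qN : q N <= q 0%N + v.
  have -> : q N = q 0%N - \sum_(i < N) (q i - q i.+1).
    by elim: (N) => [|m IH]; rewrite ?big_ord0 ?big_ord_recr /=; lra.
  rewrite lerD2l; apply: le_trans (hv N).
  by apply: le_trans (ler_norm _) _; rewrite normrN; apply: ler_norm_sum.
rewrite /series /= big_mkord abel.
have h1 : `|\sum_(i < N) (q i - q i.+1) * c i.+1| <= v * B.
  apply: le_trans (ler_norm_sum _ _ _) _.
  apply: le_trans (_ : \sum_(i < N) `|q i - q i.+1| * B <= _).
    by apply: ler_sum => i _; rewrite normrM ler_wpM2l.
  by rewrite -mulr_suml ler_wpM2r.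
have h2 : `|q N * c N| <= (q 0%N + v) * B by rewrite normrM ger0_norm // ler_pM.
have h3 : `|q 0%N * c 0%N| <= q 0%N * B by rewrite normrM ger0_norm // ler_wpM2l.
apply: le_trans (ler_normD _ _) _.
apply: le_trans (lerD (ler_normB _ _) h1) _; lra.
Qed.

Lemma inner_mean (H : hilbertType R) (f : nat -> H) (B : R) (y : H) :
  (forall n, nrm (f n) <= B) ->
  '[limn (series (fun n => (q n)%:C *: f n)), y] =
  complexify mean (fun n => '[f n, y]).
Proof.
move=> hB; set S := series _.
have B0 : 0 <= B by apply: le_trans (hB 0%N); exact: nrm_ge0.
have [|l hl] := @nrm_complete _ _ S.
  move=> e e0.
  have eB : 0 < e / (B + 1) by rewrite divr_gt0 // ltr_wpDl.
  have cq := cvg_weights; move/cvgrPdist_lt: (cq) => /(_ _ eB)[N _ hN].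
  set l := limn (series q) in hN.
  suff key m n : (n <= m)%N -> (N <= n)%N -> nrm (S m - S n) < e.
    exists N => m n Nm Nn; have [nm|/ltnW mn] := leqP n m; first exact: key.
    by rewrite -nrmN opprB; exact: key.
  move=> nm Nn.
  have hSmn : nrm (S m - S n) <= B * (series q m - series q n).
    rewrite /S sub_series_geq // sub_series_geq //.
    elim/big_rec2: _ => [|i a b _ h]; first by rewrite nrm0 mulr0.
    apply: le_trans (nrmD _ _) _; rewrite mulrDr lerD // nrmZ normcR ger0_norm //.
    by rewrite mulrC ler_wpM2r.
  have hql k : series q k <= l.
    by apply: nondecreasing_cvgn_le => //; exact: nondecreasing_series.
  have := hN n Nn; rewrite ger0_norm ?subr_ge0 // ltr_pdivlMr ?ltr_wpDl //.
  have := hql m; have := hql n => h1 h2 h3.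
  apply: le_lt_trans hSmn _; apply: le_lt_trans h3.
  have : 0 <= (l - series q m) * B by rewrite mulr_ge0 // subr_ge0.
  lra.
have -> : limn S = l by apply: cvg_lim => //; apply/nrm_cvgP.
have hSy N : '[S N, y] = \sum_(i < N) (q i)%:C * '[f i, y].
  by rewrite /S /series /= big_mkord inner_suml; apply: eq_bigr => i _; rewrite innerZl.
have cv (g : {additive R[i] -> R}) :
  (forall z, `|g z| <= normc z) -> (forall t z, g (t%:C * z) = t * g z) ->
  series (fun n => q n * g '[f n, y]) @ \oo --> g '[l, y].
  move=> gle gZ; apply/cvgrPdist_lt => e e0.
  have e1 : 0 < e / (nrm y + 1) by rewrite divr_gt0 // ltr_wpDl ?nrm_ge0.
  have [N hN] := hl _ e1; exists N => // n /= Nn.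
  have -> : series (fun n => q n * g '[f n, y]) n = g '[S n, y].
    by rewrite hSy raddf_sum /series /= big_mkord; apply: eq_bigr => i _; rewrite gZ.
  rewrite distrC -raddfB -innerBl; apply: le_lt_trans (gle _) _.
  apply: le_lt_trans (cauchy_schwarz _ _) _.
  have := hN n Nn; rewrite ltr_pdivlMr ?ltr_wpDl ?nrm_ge0 //.
  by have := nrm_ge0 (S n - l); lra.
rewrite /complexify /mean.
have hRe := cv (@complex.Re R) (@Re_le_normc R).
have hIm := cv (@complex.Im R) (@Im_le_normc R).
rewrite (cvg_lim _ (hRe _)) // ?(cvg_lim _ (hIm _)) //.
- by case: ('[l, y]).
- by move=> t [a b] /=; ring.
- by move=> t [a b] /=; ring.
Qed.

End WeightedMean.

(** * From Banach limits to limits along a net *)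

Section UltrafilterLimit.
Variables (R : realType) (T : Type) (G : set_system T).
Hypothesis UG : UltraFilter G.

Lemma ultra_bounded_cvg (f : T -> R) (B : R) : (forall t, `|f t| <= B) -> cvg (f @ G).
Proof.
move=> hB.
have hAB : (f @ G) `[- B, B]%classic.
  by apply: nearW => t /=; rewrite in_itv /= -ler_norml.
have [l [_ cl]] := @segment_compact R (- B) B _ _ hAB.
apply/cvg_ex; exists l => V Vl.
have [//|GnV] := in_ultra_setVsetC (f @^-1` V) UG.
have [z [nVz Vz]] := cl (~` V) V GnV Vl.
by [].
Qed.

End UltrafilterLimit.

Section NetOfMeans.
Variables (R : realType) (disp : Order.disp_t) (E : orderType disp).
Variable p : E -> nat -> R.
Hypothesis hp : s_regular p.

Let p0 a n : 0 <= p a n.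
Proof. by case: hp. Qed.

Lemma s_regular_sum_le a N : \sum_(i < N) p a i <= 1.
Proof.
have [_ h _ _] := hp; rewrite -lee_fin -(h a) -sumEFin.
rewrite -(big_mkord xpredT (fun i => (p a i)%:E)).
by apply: nneseries_lim_ge => i _ _; rewrite lee_fin.
Qed.

Let p1 := s_regular_sum_le.

Lemma tails_proper : ProperFilter (tails E).
Proof.
have [_ _ _ h] := hp.
(* Convergence along the tails forces [E] to be nonempty. *)
have [a _ _] : tails E setT := h 0%N setT filterT.
apply: filter_from_proper => [|i _]; last by exists i => /=.
apply: filter_fromT_filter => [|i j]; first by exists a.
by exists (Order.max i j) => b /=; rewrite ge_max => /andP.
Qed.

Lemma variation_near0 (e : R) : 0 < e ->
  \forall a \near tails E, forall N, \sum_(i < N) `|p a i - p a i.+1| <= e.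
Proof.
move=> e0; have [_ _ h _] := hp.
have /h [a _ ha] : nbhs 0%E [set x : \bar R | (x < e%:E)%E].
  exact: open_ereal_lt_ereal.
exists a => // b ab N; have /= := ha b ab => /ltW; rewrite -lee_fin; apply: le_trans.
rewrite -sumEFin -(big_mkord xpredT (fun i => `|p b i - p b i.+1|%:E)).
by apply: nneseries_lim_ge.
Qed.

(** Along the net, [p a 0] and the variation of [p a] tend to zero, so
    [mean_shift_le] gives shift invariance. *)
Lemma banach_limit_of_ultra (G : set_system E) : UltraFilter G -> tails E `<=` G ->
  banach_limit (fun c => lim (mean (p a) c @[a --> G])).
Proof.
move=> UG tG.
have PG : ProperFilter G := ultra_proper; have PT := tails_proper.
have cv c : bounded_seq c -> cvg (mean (p a) c @[a --> G]).
  by move=> [B hB]; apply: (ultra_bounded_cvg UG (B := B)) => a; exact: mean_le.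
split.
- move=> k c d bc bd; apply: cvg_lim => //.
  under eq_fun do rewrite mean_linear //.
  by apply: cvgD; [apply: cvgMr|]; exact: cv.
- move=> B c hB; rewrite ler_norml; apply/andP; split.
    apply: limr_ge; first by apply: cv; exists B.
    apply: nearW => a; have := mean_le (p0 a) (p1 a) hB.
    by rewrite ler_norml => /andP[].
  apply: limr_le; first by apply: cv; exists B.
  apply: nearW => a; have := mean_le (p0 a) (p1 a) hB.
  by rewrite ler_norml => /andP[].
- move=> c bc; case: (bc) => B hB.
  apply: cvg_lim => //; set l := lim _.
  have hd : (fun a => mean (p a) (fun n => c n.+1) - mean (p a) c) @ G --> 0.
    apply/cvgrPdist_le => e e0.
    pose k := 2 * `|B| + 1.
    have k0 : 0 < k by rewrite ltr_wpDl ?mulr_ge0.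
    have e2 : 0 < e / k / 2 by rewrite !divr_gt0.
    have h1 := tG _ (variation_near0 e2).
    have [_ _ _ /(_ 0%N)/cvgrPdist_le/(_ _ e2) /tG h2] := hp.
    apply: filterS2 h1 h2 => a ha; rewrite !sub0r !normrN => h.
    apply: le_trans (mean_shift_le (B := `|B|) (p0 a) (p1 a) (v := e / k / 2) _ ha) _.
      by move=> n; apply: le_trans (hB n) (ler_norm _).
    have {}h : p a 0%N <= e / k / 2 := le_trans (ler_norm _) h.
    rewrite [leRHS](_ : e = k * (e / k / 2 + e / k / 2)); last first.
      by rewrite -splitr mulrC divfK // gt_eqF.
    apply: ler_pM; rewrite ?mulr_ge0 ?addr_ge0 ?(ltW e2) //.
      by rewrite /k lerDl.
    by rewrite lerD2r.
  rewrite -[l]add0r.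
  have -> : (fun a => mean (p a) (fun n => c n.+1)) =
     (fun a => (mean (p a) (fun n => c n.+1) - mean (p a) c) + mean (p a) c).
    by apply/funext => a; rewrite subrK.
  by apply: cvgD => //; exact: cv.
Qed.

(** Otherwise some ultrafilter finer than the tails contains the set where the
    mean is bounded away from zero, and its Banach limit at [c] is not zero. *)
Lemma mean_cvg0 c : bounded_seq c -> (forall L, banach_limit L -> L c = 0) ->
  mean (p a) c @[a --> tails E] --> 0.
Proof.
move=> bc hc; have PT := tails_proper.
apply/cvgrPdist_lt => e e0; apply: contrapT => bad.
pose D := [set a | e <= `|mean (p a) c|].
have PD : ProperFilter (within D (tails E)).
  apply: Build_ProperFilter => h; apply: bad.
  have {}h : tails E [set a | D a -> False] := h.
  by apply: filterS h => a /= h; rewrite sub0r normrN ltNge; apply/negP.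
have [G [UG DG]] := ultraFilterLemma PD.
have tG : tails E `<=` G.
  move=> V tV; apply: DG.
  by have : tails E [set a | D a -> V a] by apply: filterS tV => a Va _.
have PG : ProperFilter G := ultra_proper.
have GD : G D.
  apply: DG; have DD : tails E [set a | D a -> D a] by apply: filterS filterT => a _.
  exact: DD.
have := hc _ (banach_limit_of_ultra UG tG) => l0.
have [B hB] := bc.
have : cvg (mean (p a) c @[a --> G]).
  by apply: (ultra_bounded_cvg UG (B := B)) => a; exact: mean_le.
move=> /cvgrPdist_lt; rewrite l0 => /(_ e e0) Ge.
have [a [/=]] := filter_ex (filterI GD Ge).
by rewrite /D /= sub0r normrN ltNge => ->.
Qed.

End NetOfMeans.

(** * Wave operators *)

Section FiniteRank.
Variables (R : realType) (H1 H2 : hilbertType R).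

(** Expand [f x] in a Parseval frame of its range; the coefficients are inner
    products with [x] because [f] has an adjoint. *)
Lemma rank_le_sum (r : nat) (f : H1 -> H2) (g : H2 -> H1) :
  rank_le r f -> adjoint_pair f g ->
  exists (u : 'I_r -> H1) (v : 'I_r -> H2), forall x, f x = \sum_k '[x, u k] *: v k.
Proof.
move=> [b fb] fg.
have [es [Es _ repr _]] := parseval_frame [seq b i | i <- enum 'I_r].
rewrite size_map size_enum_ord in Es.
exists (fun k => g (nth 0 es k)), (fun k => nth 0 es k) => x.
have [c fx] : [set y | exists c : 'I_r -> R[i], y = \sum_i c i *: b i] (f x).
  by rewrite -fb; exists x.
have fE : f x = \sum_(e <- es) '[f x, e] *: e.
  apply/esym; under eq_bigr => e _ do rewrite fx inner_suml scaler_suml.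
  rewrite exchange_big fx /=; apply: eq_bigr => i _.
  under eq_bigr => e _ do rewrite innerZl -scalerA.
  by rewrite -scaler_sumr -repr // mem_cat map_f ?mem_enum.
rewrite {1}fE (big_nth 0) big_mkord Es; apply: eq_bigr => k _.
by rewrite fg.
Qed.

End FiniteRank.

Section WaveOperatorForms.
Variables (R : realType) (H1 H2 : hilbertType R).
Variables (U1 : unitary H1) (U2 : unitary H2) (A : {linear H1 -> H2}) (M : R).
Hypotheses (bA : opbound M A).
Variables (disp : Order.disp_t) (E : orderType disp) (p : E -> nat -> R).
Hypothesis hp : s_regular p.

Lemma iter_uinv (H : hilbertType R) (U : unitary H) n x :
  iter n (uinv U) x = upow U (- n%:Z) x.
Proof. by case: n. Qed.

Let p0 a n : 0 <= p a n. Proof. by case: hp. Qed.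

Lemma inner_Wplus a x y : '[Wplus p U1 U2 A a x, y] =
  complexify (mean (p a)) (fun n => wave U1 U2 A x y n%:Z).
Proof.
rewrite /Wplus (inner_mean (p0 a) (s_regular_sum_le hp a) (B := M * nrm x)).
  congr complexify; apply/funext => n.
  by rewrite iter_uinv upow_adjoint opprK.
by move=> n; rewrite iter_uinv nrm_upow -(nrm_upow U1 n x).
Qed.

Lemma inner_Wminus a x y : '[Wminus p U1 U2 A a x, y] =
  complexify (mean (p a)) (fun n => wave U1 U2 A x y (- n%:Z)).
Proof.
rewrite /Wminus (inner_mean (p0 a) (s_regular_sum_le hp a) (B := M * nrm x)).
  congr complexify; apply/funext => n.
  by rewrite iter_uinv -[iter n U2 _]/(upow U2 n _) upow_adjoint.
move=> n; rewrite iter_uinv -[iter n U2 _]/(upow U2 n _) nrm_upow.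
by rewrite -(nrm_upow U1 (- n%:Z) x).
Qed.

Lemma inner_Wdiff a x y :
  '[Wplus p U1 U2 A a x - Wminus p U1 U2 A a x, y] =
  complexify (mean (p a)) (wave_diff U1 U2 A x y).
Proof.
rewrite innerBl inner_Wplus inner_Wminus -complexifyB //.
- exact: mean_linear (p0 a) (s_regular_sum_le hp a).
- exact: bounded_wave bA _ _ _.
- exact: bounded_wave bA _ _ _.
Qed.

End WaveOperatorForms.

Lemma cvg_sub0_iff (K : numFieldType) (V : normedModType K) (T : Type)
    (F : set_system T) (FF : Filter F) (f g : T -> V) (l : V) :
  (fun t => f t - g t) @ F --> 0 -> (f @ F --> l <-> g @ F --> l).
Proof.
move=> fg; split=> h; last exact: (cvg_sub0 (FF := FF) fg h).
apply: (cvg_sub0 (f := g) (g := f)) => //; rewrite -oppr0.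
rewrite (_ : g - f = - (f - g)); last by rewrite opprB.
exact: cvgN.
Qed.

Theorem theorem1 (R : realType) (disp : Order.disp_t) (E : orderType disp)
    (p : E -> nat -> R) (hp : s_regular p)
    (H1 H2 : hilbertType R) (U1 : unitary H1) (U2 : unitary H2)
    (sU1 : singular_unitary U1) (sU2 : singular_unitary U2)
    (A : {linear H1 -> H2}) (bA : bounded_op A)
    (rA : rank_le 2 (fun x => A (U1 x) - U2 (A x))%R) :
  wot_lim (fun a x => Wplus p U1 U2 A a x - Wminus p U1 U2 A a x)%R
          (fun=> 0%R)
  /\ (wot_cvg (Wplus p U1 U2 A) <-> wot_cvg (Wminus p U1 U2 A))
  /\ (forall Lp Lm : {linear H1 -> H2}, bounded_op Lp -> bounded_op Lm ->
        wot_lim (Wplus p U1 U2 A) Lp -> wot_lim (Wminus p U1 U2 A) Lm ->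
        Lp =1 Lm).
Proof.
have PT := tails_proper hp.
have main : wot_lim (E := E)
    (fun a x => Wplus p U1 U2 A a x - Wminus p U1 U2 A a x) (fun=> 0).
  move=> x y; rewrite inner0l.
  have [M M0 bM] := bounded_opE bA; have [A' AA'] := bounded_adjoint bA.
  have aK : adjoint_pair (fun x => A (U1 x) - U2 (A x))
      (fun y => uinv U1 (A' y) - A' (uinv U2 y)).
    by move=> x' y'; rewrite innerBl innerBr AA' !unitary_adjoint AA'.
  have [u [v commE]] := rank_le_sum rA aK.
  have bW := bounded_wave_diff U1 U2 bM x y.
  have W0 L : banach_limit L -> complexify L (wave_diff U1 U2 A x y) = 0.
    move=> hL.
    have [D [D' [DE DD' bD bD' DU]]] := wave_limit_op U1 U2 M0 bM hL.
    apply: (wave_limit_eq0 M0 bM AA' commE (singular_nearly_diagonal sU1) hL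
      (N := 2 * (2 * M)) _ DE DD' bD bD' DU).
    by rewrite !mulr_ge0.
  have /cvgrPdist_lt hRe := mean_cvg0 hp (bounded_cseqRe bW)
    (fun L hL => congr1 (@complex.Re R) (W0 L hL)).
  have /cvgrPdist_lt hIm := mean_cvg0 hp (bounded_cseqIm bW)
    (fun L hL => congr1 (@complex.Im R) (W0 L hL)).
  apply/cvgrPdist_lt => -[e e']; rewrite ltcE /= => /andP[/eqP -> e0].
  have e2 : 0 < e / 2 by rewrite divr_gt0.
  apply: filterS2 (hRe _ e2) (hIm _ e2) => a; rewrite !sub0r !normrN => h1 h2.
  rewrite (inner_Wdiff U1 U2 bM hp) normE_C ltcR; apply: le_lt_trans (normc_le_ReIm _) _.
  by rewrite /= (splitr e) ltrD.
have trans (x : H1) (y : H2) (l : R[i]) :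
  ((fun a => '[Wplus p U1 U2 A a x, y] : R[i]^o) @ tails E --> (l : R[i]^o)) <->
  ((fun a => '[Wminus p U1 U2 A a x, y] : R[i]^o) @ tails E --> (l : R[i]^o)).
  have := main x y; rewrite inner0l.
  under eq_fun do rewrite innerBl.
  exact: (@cvg_sub0_iff _ R[i]^o _ _ _ (fun a => '[Wplus p U1 U2 A a x, y])
    (fun a => '[Wminus p U1 U2 A a x, y])).
split=> //; split.
  split=> -[L bL hL]; exists L; [exact: bL| |exact: bL|].
    by move=> x y; exact: (proj1 (trans x y '[L x, y]) (hL x y)).
  by move=> x y; exact: (proj2 (trans x y '[L x, y]) (hL x y)).
move=> Lp Lm _ _ hLp hLm x; apply: inner_ext => y.
have h := proj1 (trans x y '[Lp x, y]) (hLp x y).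
exact: (@cvg_unique R[i]^o (@norm_hausdorff _ R[i]^o) _ _ _ _ h (hLm x y)).
Qed.
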